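(* Let $A$ be a $\sigma$-unital strongly $\mathbb{Z}$-graded $C^*$-algebra, with graded subspaces $A_n$, $n \in \mathbb{Z}$. Then $X := A_1$, with left and right actions of $A_0$ given by multiplication in $A$ and inner product $\langle x, y\rangle_{A_0} = x^*y$, is a full $C^*$-correspondence over $A_0$ with compact injective left action, and there is an isomorphism $\Psi : A \cong \mathcal{O}_X$ such that $\Psi|_{A_1} = j_X$ and $\Psi|_{A_0} = j_{A_0}$, where $(j_{A_0}, j_X)$ is the universal covariant representation of $X$ in its Cuntz--Pimsner algebra $\mathcal{O}_X$.
   Context: A $\mathbb{Z}$-grading of a $C^*$-algebra $A$ is a collection of closed subspaces $A_n$, $n \in \mathbb{Z}$, such that $A_0$ is a $C^*$-subalgebra; $A_m A_n \subseteq A_{m+n}$ and $A_{-n} = A_n^*$ for all $m,n$; $A = \overline{\operatorname{span}} \bigcup_n A_n$; and there is a positive norm-decreasing linear map $E : A \to A_0$ with $E|_{A_0} = \operatorname{id}$ and $E(A_n) = \{0\}$ for $n \neq 0$. It is strong if $\overline{\operatorname{span}}\, A_m A_n = A_{m+n}$ for all $m,n$. A $C^*$-correspondence over a $C^*$-algebra $B$ is a right-Hilbert $B$-module $X$ (complete, inner product $\langle\cdot,\cdot\rangle_B$ linear in the second variable) with a left action of $B$ by adjointable operators given by a homomorphism $\phi_X : B \to \mathcal{L}(X)$. It is full if $\overline{\operatorname{span}}\langle X, X\rangle_B = B$. The compact operators are $\mathcal{K}(X) = \overline{\operatorname{span}}\{\theta_{x,y} : x,y\in X\}$, $\theta_{x,y}(z)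 = x\cdot\langle y,z\rangle_B$. The left action is compact if $\phi_X(B) \subseteq \mathcal{K}(X)$ and injective if $\phi_X$ is injective; $X$ is regular if its left action is both compact and injective. A representation of a regular correspondence $X$ over $B$ in a $C^*$-algebra $D$ is a pair $(\pi,\psi)$ of a homomorphism $\pi : B \to D$ and a linear map $\psi : X \to D$ with $\psi(b\cdot x) = \pi(b)\psi(x)$, $\psi(x\cdot b) = \psi(x)\pi(b)$ and $\psi(x)^*\psi(y) = \pi(\langle x,y\rangle_B)$. It induces a homomorphism $\psi^{(1)} : \mathcal{K}(X)\to D$ with $\psi^{(1)}(\theta_{x,y}) = \psi(x)\psi(y)^*$, and it is covariant if $\psi^{(1)}(\phi_X(b)) = \pi(b)$ for all $b \in B$. The Cuntz--Pimsner algebra $\mathcal{O}_X$ is the universal $C^*$-algebra generated by the image of a covariant representation $(j_B, j_X)$ of $X$. *)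

(* Defs.v *)
From HB Require Import structures.
From mathcomp Require Import all_boot all_order all_algebra.
From mathcomp Require Import complex.
From mathcomp Require Import all_classical all_reals all_analysis.

Set Implicit Arguments.
Unset Strict Implicit.
Unset Printing Implicit Defensive.

Import Order.TTheory GRing.Theory Num.Theory.
Import numFieldNormedType.Exports.

Local Open Scope classical_set_scope.
Local Open Scope ring_scope.

(* C*-algebras need not be unital, so the product is not a ring product.  The
   scalars are R[i]; norms are valued in R[i] too (they are real there). *)
HB.mixin Record isCStarAlgebra (R : realType) A
    & CompleteNormedModule R[i] A := {
  cmul : A -> A -> A;
  cstar : A -> A;
  cmulA : associative cmul;
  cmulDl : left_distributive cmul +%R;
  cmulDr : right_distributive cmul +%R;
  cmulZl : forall (k : R[i]) (a b : A), cmul (k *: a) b = k *: cmul a b;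
  cmulZr : forall (k : R[i]) (a b : A), cmul a (k *: b) = k *: cmul a b;
  cstarK : involutive cstar;
  cstarD : {morph cstar : a b / a + b};
  cstarZ : forall (k : R[i]) (a : A), cstar (k *: a) = k^* *: cstar a;
  cstarM : forall a b : A, cstar (cmul a b) = cmul (cstar b) (cstar a);
  cnormM : forall a b : A, `|cmul a b| <= `|a| * `|b|;
  cnorm_star : forall a : A, `|cmul (cstar a) a| = `|a| ^+ 2
}.

#[short(type="cstarAlgType")]
HB.structure Definition CStarAlgebra (R : realType) :=
  {A of CompleteNormedModule R[i] A & isCStarAlgebra R A}.

Notation "a ** b" := (cmul a b) (at level 40, left associativity) : ring_scope.

Section CStarNotions.
Variable R : realType.

Definition star_hom (A B : cstarAlgType R) (f : A -> B) : Prop :=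
  [/\ linear f,
      forall a b, f (a ** b) = f a ** f b &
      forall a, f (cstar a) = cstar (f a)].

Definition star_iso (A B : cstarAlgType R) (f : A -> B) : Prop :=
  star_hom f /\ bijective f.

Definition cpositive (A : cstarAlgType R) (a : A) : Prop :=
  exists b : A, a = cstar b ** b.

Definition sigma_unital (A : cstarAlgType R) : Prop :=
  exists e : nat -> A,
    [/\ forall n, cpositive (e n),
        forall n, `|e n| <= 1,
        forall n, cpositive (e n.+1 - e n),
        forall a, e n ** a @[n --> \oo] --> a &
        forall a, a ** e n @[n --> \oo] --> a].

Definition lspan (V : lmodType R[i]) (S : set V) : set V :=
  smallest (fun M : set V => submod_closed [in M]) S.

Definition closed_span (V : normedModType R[i]) (S : set V) : set V :=
  closure (lspan S).

Definition mul_set (A : cstarAlgType R) (S T : set A) : set A :=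
  [set a | exists x y, [/\ S x, T y & a = x ** y]].

Definition mul_star_closed (A : cstarAlgType R) (S : set A) : Prop :=
  (forall a b, S a -> S b -> S (a ** b)) /\ (forall a, S a -> S (cstar a)).

End CStarNotions.

Record closed_subspace (R : realType) (V : completeNormedModType R[i]) :=
  ClosedSubspace {
    cs_set :> set V;
    cs_submod : submod_closed [in cs_set];
    cs_closed : closed cs_set
  }.

Section SubspaceType.
Variables (R : realType) (V : completeNormedModType R[i]).
Variable S : closed_subspace V.

Record subspace_type : Type := SubspaceElt {
  sub_val :> V;
  sub_valP : sub_val \in cs_set S
}.

HB.instance Definition _ := [isSub for sub_val].
HB.instance Definition _ := [Choice of subspace_type by <:].

Fact subspace_type_closed :
  subsemimod_closed (fun x : V => x \in cs_set S).
Proof.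
have [S0 SL] := cs_submod S; split; first split => //.
- by move=> u v Su Sv; have := SL 1 u v Su Sv; rewrite scale1r.
- by move=> a u Su; have := SL a u 0 Su S0; rewrite addr0.
Qed.

HB.instance Definition _ :=
  GRing.SubChoice_isSubLmodule.Build R[i] V _ subspace_type
    subspace_type_closed.

Fact sub_norm_triangle (x y : subspace_type) :
  `|val (x + y)| <= `|val x| + `|val y|.
Proof. by rewrite raddfD ler_normD. Qed.

Fact sub_normZ (l : R[i]) (x : subspace_type) :
  `|val (l *: x)| = `|l| * `|val x|.
Proof. by rewrite linearZ normrZ. Qed.

Fact sub_norm_eq0 (x : subspace_type) : `|val x| = 0 -> x = 0.
Proof. by move/normr0_eq0 => x0; apply: val_inj; rewrite x0 raddf0. Qed.

HB.instance Definition _ :=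
  Lmodule_isNormed.Build R[i] subspace_type
    sub_norm_triangle sub_normZ sub_norm_eq0.

Lemma sub_normE (x : subspace_type) : `|x| = `|val x|.
Proof. by []. Qed.

Fact subspace_complete (F : set_system subspace_type) :
  ProperFilter F -> cauchy F -> cvg F.
Proof.
move=> FF /cauchy_ballP Fc.
have Gc : cauchy ((@sub_val) @ F).
  apply/cauchy_ballP => e e0; have := Fc e e0.
  rewrite /prop_near2 => -[[P Q] /= [FP FQ] PQ].
  exists ((fun y => exists2 x, P x & y = sub_val x),
          (fun y => exists2 x, Q x & y = sub_val x)) => /=.
    by split; [apply: filterS FP|apply: filterS FQ] => x ? /=; exists x.
  move=> [_ _] /= [[x Px ->] [y Qy ->]].
  by have := PQ (x, y) (conj Px Qy); rewrite /= -!ball_normE.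
have [l Fl] := (cvg_ex _).1 (cauchy_cvg _ Gc).
have Sl : l \in cs_set S.
  apply/mem_set; apply: (closed_cvg (cs_set S) (@cs_closed _ _ S) _ _ Fl).
  by near=> x; apply/set_mem; exact: (sub_valP x).
apply/(cvg_ex _); exists (SubspaceElt Sl); apply/cvgrPdist_lt => e e0.
by have /cvgrPdist_lt/(_ e e0) := Fl.
Unshelve. all: by end_near. Qed.

HB.instance Definition _ :=
  Uniform_isComplete.Build subspace_type subspace_complete.

End SubspaceType.

Arguments SubspaceElt {R V S}.
Arguments sub_val {R V S}.

Record sub_cstar (R : realType) (A : cstarAlgType R) := SubCStar {
  sc_space :> closed_subspace A;
  sc_closed : mul_star_closed sc_space
}.

Section SubCStarType.
Variables (R : realType) (A : cstarAlgType R) (S : sub_cstar A).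

Definition sub_cstar_type : Type := subspace_type S.

HB.instance Definition _ :=
  CompleteNormedModule.copy sub_cstar_type (subspace_type S).

Fact sub_mul_subproof (a b : sub_cstar_type) :
  (sub_val a : A) ** sub_val b \in cs_set S.
Proof.
by apply/mem_set; apply: (sc_closed S).1; apply/set_mem; apply: sub_valP.
Qed.

Fact sub_star_subproof (a : sub_cstar_type) :
  cstar (sub_val a : A) \in cs_set S.
Proof.
by apply/mem_set; apply: (sc_closed S).2; apply/set_mem; apply: sub_valP.
Qed.

Definition sub_mul (a b : sub_cstar_type) : sub_cstar_type :=
  SubspaceElt _ (sub_mul_subproof a b).

Definition sub_star (a : sub_cstar_type) : sub_cstar_type :=
  SubspaceElt _ (sub_star_subproof a).

Fact sub_mulA : associative sub_mul.
Proof. by move=> a b c; apply: val_inj; apply: cmulA. Qed.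
Fact sub_mulDl : left_distributive sub_mul +%R.
Proof. by move=> a b c; apply: val_inj; apply: cmulDl. Qed.
Fact sub_mulDr : right_distributive sub_mul +%R.
Proof. by move=> a b c; apply: val_inj; apply: cmulDr. Qed.
Fact sub_mulZl (k : R[i]) a b : sub_mul (k *: a) b = k *: sub_mul a b.
Proof. by apply: val_inj; apply: cmulZl. Qed.
Fact sub_mulZr (k : R[i]) a b : sub_mul a (k *: b) = k *: sub_mul a b.
Proof. by apply: val_inj; apply: cmulZr. Qed.
Fact sub_starK : involutive sub_star.
Proof. by move=> a; apply: val_inj; apply: cstarK. Qed.
Fact sub_starD : {morph sub_star : a b / a + b}.
Proof. by move=> a b; apply: val_inj; apply: cstarD. Qed.
Fact sub_starZ (k : R[i]) a : sub_star (k *: a) = k^* *: sub_star a.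
Proof. by apply: val_inj; apply: cstarZ. Qed.
Fact sub_starM a b : sub_star (sub_mul a b) = sub_mul (sub_star b) (sub_star a).
Proof. by apply: val_inj; apply: cstarM. Qed.
Fact sub_normM a b : `|sub_mul a b| <= `|a| * `|b|.
Proof. exact: cnormM. Qed.
Fact sub_norm_star a : `|sub_mul (sub_star a) a| = `|a| ^+ 2.
Proof. exact: cnorm_star. Qed.

HB.instance Definition _ := isCStarAlgebra.Build R sub_cstar_type
  sub_mulA sub_mulDl sub_mulDr sub_mulZl sub_mulZr
  sub_starK sub_starD sub_starZ sub_starM sub_normM sub_norm_star.

End SubCStarType.

(* The operations of a C*-correspondence; its norm and its completeness are
   those of X, tied to the inner product by corr_norm below. *)
Record corr_data (R : realType) (B : cstarAlgType R)
    (X : completeNormedModType R[i]) := CorrData {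
  ip : X -> X -> B;
  ract : X -> B -> X;
  lact : B -> X -> X
}.

Section Correspondence.
Variables (R : realType) (B : cstarAlgType R) (X : completeNormedModType R[i]).
Variable c : corr_data B X.

Definition adjoint_of (T T' : X -> X) : Prop :=
  forall x y, ip c (T x) y = ip c x (T' y).

Definition adjointable (T : X -> X) : Prop := exists T', adjoint_of T T'.

Record hilbert_module : Prop := HilbertModule {
  ractDl : forall x y b, ract c (x + y) b = ract c x b + ract c y b;
  ractDr : forall x a b, ract c x (a + b) = ract c x a + ract c x b;
  ractZl : forall (k : R[i]) x b, ract c (k *: x) b = k *: ract c x b;
  ractZr : forall (k : R[i]) x b, ract c x (k *: b) = k *: ract c x b;
  ractM : forall x a b, ract c x (a ** b) = ract c (ract c x a) b;
  ip_linear : forall x, linear (ip c x);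
  ip_ract : forall x y b, ip c x (ract c y b) = ip c x y ** b;
  ip_star : forall x y, cstar (ip c x y) = ip c y x;
  ip_pos : forall x, cpositive (ip c x x);
  ip_eq0 : forall x, ip c x x = 0 -> x = 0;
  corr_norm : forall x, `|x| ^+ 2 = `|ip c x x|
}.

Record correspondence : Prop := Correspondence {
  corr_hilbert : hilbert_module;
  lact_linear : forall (k : R[i]) a b x,
    lact c (k *: a + b) x = k *: lact c a x + lact c b x;
  lactM : forall a b x, lact c (a ** b) x = lact c a (lact c b x);
  lact_adjoint : forall b, adjoint_of (lact c b) (lact c (cstar b))
}.

Definition full : Prop :=
  closed_span [set b | exists x y, b = ip c x y] = setT.

Definition theta (x y : X) : X -> X := fun z => ract c x (ip c y z).

Definition finite_rank : set (X -> X) :=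
  lspan [set T : X -> X | exists x y, T = theta x y].

(* The closure is that of the operator norm of L(X). *)
Definition compact_op : set (X -> X) :=
  [set T | adjointable T /\
     forall e : R[i], 0 < e ->
       exists2 F, finite_rank F & forall z, `|T z - F z| <= e * `|z|].

Definition compact_left_action : Prop := forall b, compact_op (lact c b).

Definition injective_left_action : Prop := injective (lact c).

Section Representation.
Variables (D : cstarAlgType R) (pi : B -> D) (psi : X -> D).

Definition representation : Prop :=
  [/\ star_hom pi, linear psi,
      forall b x, psi (lact c b x) = pi b ** psi x,
      forall x b, psi (ract c x b) = psi x ** pi b &
      forall x y, cstar (psi x) ** psi y = pi (ip c x y)].

(* psi1 stands for a map K(X) -> D: it is a total function on operators,
   constrained on K(X) only. *)
Definition induced_hom (psi1 : (X -> X) -> D) : Prop :=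
  [/\ forall (k : R[i]) T T', compact_op T -> compact_op T' ->
        psi1 (k *: T + T') = k *: psi1 T + psi1 T',
      forall T T', compact_op T -> compact_op T' ->
        psi1 (T \o T') = psi1 T ** psi1 T',
      forall T T', compact_op T -> compact_op T' -> adjoint_of T T' ->
        psi1 T' = cstar (psi1 T) &
      forall x y, psi1 (theta x y) = psi x ** cstar (psi y)].

Definition covariant_representation : Prop :=
  representation /\
  exists2 psi1, induced_hom psi1 & forall b, psi1 (lact c b) = pi b.

End Representation.

Definition generates (D : cstarAlgType R) (S : set D) : Prop :=
  forall C : sub_cstar D, S `<=` C -> cs_set C = setT.

(* The universal property; the uniqueness of f follows from generation. *)
Definition cuntz_pimsner (O : cstarAlgType R) (jB : B -> O) (jX : X -> O) :
    Prop :=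
  [/\ covariant_representation jB jX,
      generates (range jB `|` range jX) &
      forall (D : cstarAlgType R) (pi : B -> D) (psi : X -> D),
        covariant_representation pi psi ->
        exists f : O -> D,
          [/\ star_hom f, f \o jB = pi & f \o jX = psi]].

End Correspondence.

Record zgrading (R : realType) (A : cstarAlgType R) := ZGrading {
  gr : int -> closed_subspace A;
  gr_alg0 : mul_star_closed (gr 0);
  gr_mul : forall m n, mul_set (gr m) (gr n) `<=` gr (m + n);
  gr_star : forall n, cs_set (gr (- n)) = cstar @` gr n;
  gr_dense : closed_span (\bigcup_n cs_set (gr n)) = setT;
  gr_exp : exists E : A -> sub_cstar_type (SubCStar gr_alg0),
    [/\ linear E,
        forall a, cpositive a -> cpositive (E a),
        forall a, `|E a| <= `|a|,
        forall a, E (sub_val a) = a &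
        forall n a, n != 0 -> cs_set (gr n) a -> E a = 0]
}.

Section Graded.
Variables (R : realType) (A : cstarAlgType R) (G : zgrading A).

Definition strong : Prop :=
  forall m n, closed_span (mul_set (gr G m) (gr G n)) = gr G (m + n).

Definition A0 : cstarAlgType R := sub_cstar_type (SubCStar (gr_alg0 G)).

Definition A1 : completeNormedModType R[i] := subspace_type (gr G 1).

Lemma gr_mulP m n (x y : A) : x \in cs_set (gr G m) -> y \in cs_set (gr G n) ->
  x ** y \in cs_set (gr G (m + n)).
Proof.
move=> /set_mem xm /set_mem yn; apply/mem_set; apply: gr_mul.
by exists x, y.
Qed.

Fact A1_ip_subproof (x y : A1) :
  cstar (sub_val x : A) ** sub_val y \in cs_set (gr G 0).
Proof.
apply: (@gr_mulP (-1) 1); last exact: sub_valP.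
apply/mem_set; rewrite gr_star; exists (sub_val x) => //.
by apply/set_mem; apply: sub_valP.
Qed.

Fact A1_ract_subproof (x : A1) (b : A0) :
  (sub_val x : A) ** sub_val b \in cs_set (gr G 1).
Proof. by apply: (@gr_mulP 1 0); apply: sub_valP. Qed.

Fact A1_lact_subproof (b : A0) (x : A1) :
  (sub_val b : A) ** sub_val x \in cs_set (gr G 1).
Proof. by apply: (@gr_mulP 0 1); apply: sub_valP. Qed.

Definition A1_corr : corr_data A0 A1 :=
  CorrData
    (fun x y : A1 => SubspaceElt _ (A1_ip_subproof x y) : A0)
    (fun (x : A1) (b : A0) => SubspaceElt _ (A1_ract_subproof x b) : A1)
    (fun (b : A0) (x : A1) => SubspaceElt _ (A1_lact_subproof b x) : A1).

End Graded.

(* Main.v *)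
Require Import Defs.
From HB Require Import structures.
From mathcomp Require Import all_boot all_order all_algebra.
From mathcomp Require Import complex.
From mathcomp Require Import all_classical all_reals all_analysis.
From mathcomp Require Import ring lra zify.
Import Order.TTheory GRing.Theory Num.Theory.
Import numFieldNormedType.Exports.
Local Open Scope classical_set_scope.
Local Open Scope ring_scope.

Set Implicit Arguments.
Unset Strict Implicit.
Unset Printing Implicit Defensive.

(** The algebra [A], with the inclusions of [A_0] and [A_1], is itself a
    Cuntz-Pimsner algebra of [A_1]; any other one is then isomorphic to it,
    because two star homomorphisms that agree on generators are equal
    ([star_hom_eq]).

    Strength makes [A_0] the closed span of the products [x y^*] with [x], [y] in
    [A_1], and left multiplication by [x y^*] is the rank-one operator [theta x y].
    So the left action is by compact operators, and since it is bounded below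
    ([lact_norm]) every compact operator on [A_1] is the action of exactly one
    element of [A_0] ([compact_lact]).  This gives the map on compact operators
    that covariance of the inclusions requires.

    For the universal property, a covariant representation [(pi, psi)] in [D]
    determines a homomorphism on the dense star subalgebra of [A] generated by [A_0]
    and [A_1].  It is constructed through its graph: in degree [n >= 0] the pairs
    [(x_1 ... x_n b, psi x_1 ... psi x_n pi b)] and their linear combinations.
    Covariance makes these graphs, together with their adjoints, multiplicative
    ([graded_pairM]), and in degree zero only the graph of [pi] remains.

    The graph must be shown contractive, for the given norm of [A].  This is where
    the grading group matters.  Homogeneous pairs are contractive by the C*-identity
    and the contractivity of [pi].  The conditional expectation bounds every
    homogeneous component of [a] by [a] ([component_le]), so a pair [(a, d)] with
    [2 N + 1] components satisfies [nrm d <= (2 N + 1) * nrm a].  Applied to the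
    powers of [(a^* a, d^* d)], whose number of components grows linearly, the
    C*-identity removes the factor ([band_le]).

    Contractivity of star homomorphisms is proved without spectra: for a
    self-adjoint [a] of norm less than one, a square root of [1 - a^2] exhibits
    the image of [a] as the real part of a unitary ([unitary_bound]). *)

(** * Real-valued norms and linear spans *)

Section LinearSpan.
Variables (R : realType) (V : lmodType R[i]).

Lemma submodP (M : set V) : M 0 ->
  (forall (k : R[i]) u v, M u -> M v -> M (k *: u + v)) ->
  submod_closed [in M].
Proof.
move=> M0 ML; split; first exact/mem_set.
by move=> k u v /set_mem Mu /set_mem Mv; apply/mem_set/ML.
Qed.

Lemma lspan_sub (S M : set V) : M 0 ->
  (forall (k : R[i]) u v, M u -> M v -> M (k *: u + v)) ->
  S `<=` M -> lspan S `<=` M.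
Proof. by move=> M0 ML SM x; apply; split=> //; exact: submodP. Qed.

Lemma lspan_gen (S : set V) : S `<=` lspan S.
Proof. by move=> x Sx M [_]; apply. Qed.

Lemma lspan0 (S : set V) : lspan S 0.
Proof. by move=> M [[/set_mem M0 _] _]. Qed.

Lemma lspanL (S : set V) (k : R[i]) u v :
  lspan S u -> lspan S v -> lspan S (k *: u + v).
Proof.
move=> Su Sv M MS; apply/set_mem; apply: MS.1.2; apply/mem_set.
  exact: Su.
exact: Sv.
Qed.

End LinearSpan.

Section RealNorm.
Variables (R : realType) (V : normedModType R[i]).
Implicit Types x y z : V.

(** Norms over [R[i]] take values in the partially ordered field [R[i]]; their
    real part lives in [R], where the order is total and [lra] applies. *)
Definition nrm x : R := complex.Re `|x|.

Lemma nrmE x : `|x| = (nrm x)%:C%C.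
Proof. by rewrite /nrm (RRe_real (normr_real _)). Qed.

Lemma nrm_ge0 x : 0 <= nrm x.
Proof. by rewrite -lecR -nrmE; exact: normr_ge0. Qed.

Lemma nrmD x y : nrm (x + y) <= nrm x + nrm y.
Proof. by rewrite -lecR rmorphD/= -!nrmE ler_normD. Qed.

Lemma nrmN x : nrm (- x) = nrm x.
Proof. by rewrite /nrm normrN. Qed.

Lemma nrmB x y : nrm (x - y) <= nrm x + nrm y.
Proof. by rewrite -(nrmN y) nrmD. Qed.

Lemma nrm_distC x y : nrm (x - y) = nrm (y - x).
Proof. by rewrite -nrmN opprB. Qed.

Lemma nrm_dist x y z : nrm (x - z) <= nrm (x - y) + nrm (y - z).
Proof. by apply: le_trans (nrmD _ _); rewrite subrKA. Qed.

Lemma nrmZ (k : R[i]) x : nrm (k *: x) = complex.Re `|k| * nrm x.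
Proof.
by rewrite {1}/nrm normrZ nrmE -(RRe_real (normr_real k)) -rmorphM.
Qed.

Lemma nrm0 : nrm 0 = 0.
Proof. by rewrite /nrm normr0. Qed.

Lemma nrm0_eq0 x : nrm x = 0 -> x = 0.
Proof. by move=> x0; apply: normr0_eq0; rewrite nrmE x0. Qed.

Lemma nrm_lt_eq0 x : (forall e, 0 < e -> nrm x <= e) -> x = 0.
Proof.
move=> H; apply: nrm0_eq0; apply/eqP; rewrite eq_le nrm_ge0 andbT.
by apply/ler_addgt0Pr => e e0; rewrite add0r H.
Qed.

Lemma Renorm_ge0 (k : R[i]) : 0 <= complex.Re `|k|.
Proof. by rewrite -lecR (RRe_real (normr_real _)); exact: normr_ge0. Qed.

Lemma nrm_sum n (f : 'I_n -> V) (C : R) :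
  (forall i, nrm (f i) <= C) -> nrm (\sum_i f i) <= n%:R * C.
Proof.
move=> fC; elim: n f fC => [|n IH] f fC; first by rewrite big_ord0 nrm0 mul0r.
rewrite big_ord_recr/= (le_trans (nrmD _ _))// -natr1 mulrDl mul1r lerD//.
exact: IH.
Qed.

Lemma closureP (S : set V) x :
  closure S x <-> forall e : R, 0 < e -> exists2 y, S y & nrm (x - y) < e.
Proof.
split=> [clS e e0|H B].
- have /clS [y [Sy]] : nbhs x (ball x (e%:C%C)).
    by apply: nbhsx_ballx; rewrite ltcR.
  by rewrite -ball_normE /ball_/= nrmE ltcR => xy; exists y.
- move=> /nbhs_ballP [e e0 eB].
  have eE : e = (complex.Re e)%:C%C by rewrite RRe_real// gtr0_real.
  have e0' : 0 < complex.Re e by rewrite -ltcR -eE.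
  have [y Sy xy] := H _ e0'; exists y; split=> //; apply: eB.
  by rewrite -ball_normE /ball_/= nrmE eE ltcR.
Qed.

Lemma closedP (S : set V) : closed S <->
  forall x, (forall e : R, 0 < e -> exists2 y, S y & nrm (x - y) < e) -> S x.
Proof.
split=> [clS x /closureP|H x /closureP]; [exact: clS|exact: H].
Qed.

Lemma closed_span_sub (S M : set V) : M 0 ->
  (forall (k : R[i]) u v, M u -> M v -> M (k *: u + v)) ->
  closed M -> S `<=` M -> closed_span S `<=` M.
Proof.
move=> M0 ML clM SM; apply: subset_trans (closure_subset _) _.
  exact: (lspan_sub M0 ML SM).
exact: clM.
Qed.

End RealNorm.

Lemma subspace0 (R : realType) (V : completeNormedModType R[i])
  (S : closed_subspace V) : cs_set S 0.
Proof. by apply/set_mem; have [] := cs_submod S. Qed.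

Lemma subspaceL (R : realType) (V : completeNormedModType R[i])
  (S : closed_subspace V) (k : R[i]) u v :
  cs_set S u -> cs_set S v -> cs_set S (k *: u + v).
Proof.
move=> Su Sv; apply/set_mem; have [_ H] := cs_submod S.
by apply: H; apply/mem_set.
Qed.

Lemma complete_seq (R : realType) (V : completeNormedModType R[i])
    (u : nat -> V) :
  (forall e : R, 0 < e -> exists N, forall m n, (N <= m)%N -> (N <= n)%N ->
     nrm (u m - u n) < e) ->
  exists l, forall e : R, 0 < e -> exists N, forall n, (N <= n)%N ->
     nrm (u n - l) < e.
Proof.
move=> uC.
have C : cauchy (u @ \oo).
  apply/cauchy_ballP => e e0; rewrite /prop_near2.
  have eE : e = (complex.Re e)%:C%C by rewrite RRe_real// gtr0_real.
  have [|N HN] := uC (complex.Re e); first by rewrite -ltcR -eE.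
  exists (u @` [set n | (N <= n)%N], u @` [set n | (N <= n)%N]).
    by split; exists N => // n /= Nn; exists n.
  move=> [_ _] /= [[m Nm <-] [n Nn <-]].
  by rewrite -ball_normE /ball_/= nrmE eE ltcR; exact: HN.
have [l ul] := (cvg_ex _).1 (cauchy_cvg _ C).
exists l => e e0; have /cvgrPdist_lt/(_ e%:C%C) := ul.
rewrite ltcR => /(_ e0) [N _ HN]; exists N => n /HN/=.
by rewrite nrmE ltcR nrm_distC.
Qed.

(** * Comparing geometric growth with linear growth *)

Lemma expr_lin_bound (R : realType) (t a b : R) :
  (forall n, t ^+ n.+1 <= a * n.+1%:R + b) -> t <= 1.
Proof.
move=> H; rewrite leNgt; apply/negP => t1.
pose d := t - 1; have d0 : 0 < d by rewrite subr_gt0.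
(* the binomial theorem up to order two already outgrows a linear bound *)
have key n : 1 + n%:R * d + n%:R * (n%:R - 1) / 2 * d ^+ 2 <= t ^+ n.
  elim: n => [|n IH]; first by rewrite expr0 !mul0r; lra.
  have n0 : 0 <= n%:R :> R by [].
  have nn : 0 <= n%:R * (n%:R - 1) :> R.
    case: n {IH n0} => [|n]; first by rewrite mul0r.
    by apply: mulr_ge0 => //; rewrite subr_ge0 ler1n.
  have tE : t = 1 + d by rewrite /d; ring.
  rewrite (exprS t) {1}tE.
  apply: (@le_trans _ _ ((1 + d) *
    (1 + n%:R * d + n%:R * (n%:R - 1) / 2 * d ^+ 2))); last first.
    by rewrite ler_wpM2l//; lra.
  rewrite -natr1 -subr_ge0.
  suff -> : (1 + d) * (1 + n%:R * d + n%:R * (n%:R - 1) / 2 * d ^+ 2) -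
     (1 + (n%:R + 1) * d + (n%:R + 1) * (n%:R + 1 - 1) / 2 * d ^+ 2) =
     n%:R * (n%:R - 1) / 2 * (d ^+ 2 * d).
    by apply: mulr_ge0; rewrite ?divr_ge0// mulr_ge0 ?sqr_ge0// ltW.
  by field.
pose c := d ^+ 2 / 2; have c0 : 0 < c by rewrite divr_gt0// exprn_gt0.
have b2 n : c * n%:R <= `|a| + `|b|.
  have := le_trans (key n.+1) (H n).
  rewrite -natr1 addrK -/c => K.
  have n1 : 0 <= n%:R :> R by [].
  have aa := ler_norm a; have bb := ler_norm b.
  have b0 := normr_ge0 b.
  rewrite -(@ler_pM2r _ (n%:R + 1)); last by lra.
  have e1 : (n%:R + 1) * n%:R / 2 * d ^+ 2 = c * n%:R * (n%:R + 1).
    by rewrite /c; field.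
  have e2 : 0 <= (n%:R + 1) * d by apply: mulr_ge0; lra.
  have e3 : a * (n%:R + 1) <= `|a| * (n%:R + 1) by rewrite ler_wpM2r//; lra.
  have e4 : 0 <= `|b| * n%:R by apply: mulr_ge0.
  lra.
have [N HN] : exists N, (`|a| + `|b|) / c < N%:R.
  exists (Num.bound ((`|a| + `|b|) / c)); apply: archi_boundP.
  by rewrite divr_ge0 ?addr_ge0// ltW.
by have := b2 N; rewrite leNgt -ltr_pdivrMl// mulrC HN.
Qed.

(** A linear factor disappears after taking [n]-th roots.  Both norm estimates
    below come from this: a crude bound on all powers gives a sharp one. *)
Lemma expr_growth (R : realType) (x y a b : R) : 0 <= x -> 0 <= y ->
  (forall n, x ^+ n.+1 <= (a * n.+1%:R + b) * y ^+ n.+1) -> x <= y.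
Proof.
move=> x0 y0 H; have [yz|yn|yE] := ltgtP 0 y; last 2 first.
- by move: y0; rewrite leNgt yn.
- by have := H 0%N; rewrite -yE !expr1 mulr0.
rewrite -[leRHS]mul1r -ler_pdivrMr//; apply: (@expr_lin_bound _ _ a b) => n.
by rewrite expr_div_n ler_pdivrMr ?exprn_gt0.
Qed.

Lemma expr_lt_eps (R : realType) (r e : R) : 0 <= r -> r < 1 -> 0 < e ->
  exists n, r ^+ n < e.
Proof.
move=> r0 r1 e0.
have /cvgrPdist_lt/(_ e e0) [N _ HN] : (fun n => r ^+ n) @ \oo --> (0 : R).
  by apply: cvg_expr; rewrite ger0_norm.
exists N; have := HN N (leqnn N).
by rewrite /= sub0r normrN ger0_norm// exprn_ge0.
Qed.

Lemma inv_succ_gt0 (R : realType) n : 0 < n.+1%:R^-1 :> R.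
Proof. by rewrite invr_gt0. Qed.

Lemma inv_succ_small (R : realType) (e : R) : 0 < e ->
  exists N, forall n, (N <= n)%N -> n.+1%:R^-1 < e.
Proof.
move=> e0; have := near_infty_natSinv_lt (PosNum e0) => -[N _ HN].
by exists N => n Nn; exact: HN.
Qed.

(** * Powers and square roots in a C*-algebra *)

Section CStarBasics.
Variables (R : realType) (A : cstarAlgType R).
Implicit Types a b c : A.

Lemma cmul0l a : 0 ** a = 0.
Proof. by rewrite -(scale0r (0 : A)) cmulZl !scale0r. Qed.

Lemma cmul0r a : a ** 0 = 0.
Proof. by rewrite -(scale0r (0 : A)) cmulZr !scale0r. Qed.

Lemma cmulNl a b : (- a) ** b = - (a ** b).
Proof. by rewrite -(scaleN1r a) cmulZl scaleN1r. Qed.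

Lemma cmulNr a b : a ** (- b) = - (a ** b).
Proof. by rewrite -(scaleN1r b) cmulZr scaleN1r. Qed.

Lemma cmulBl a b c : (a - b) ** c = a ** c - b ** c.
Proof. by rewrite cmulDl cmulNl. Qed.

Lemma cmulBr a b c : a ** (b - c) = a ** b - a ** c.
Proof. by rewrite cmulDr cmulNr. Qed.

Lemma cstar0 : cstar 0 = 0 :> A.
Proof. by rewrite -(scale0r (0 : A)) cstarZ conjC0 !scale0r. Qed.

Lemma cstarN a : cstar (- a) = - cstar a.
Proof. by rewrite -(scaleN1r a) cstarZ rmorphN1 scaleN1r. Qed.

Lemma cstarB a b : cstar (a - b) = cstar a - cstar b.
Proof. by rewrite cstarD cstarN. Qed.

Lemma cstarL (k : R[i]) a b : cstar (k *: a + b) = k^* *: cstar a + cstar b.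
Proof. by rewrite cstarD cstarZ. Qed.

Lemma nrmM a b : nrm (a ** b) <= nrm a * nrm b.
Proof. by rewrite -lecR rmorphM/= -!nrmE cnormM. Qed.

Lemma nrm_star_mul a : nrm (cstar a ** a) = nrm a ^+ 2.
Proof. by apply: complexI; rewrite rmorphXn/= -!nrmE cnorm_star. Qed.

Lemma nrm_star a : nrm (cstar a) = nrm a.
Proof.
suff H b : nrm b <= nrm (cstar b).
  by apply/eqP; rewrite eq_le H -{2}(cstarK a) H.
have [->|b0] := eqVneq (nrm b) 0; first exact: nrm_ge0.
have bp : 0 < nrm b by rewrite lt_def b0 nrm_ge0.
by rewrite -(ler_pM2r bp) -expr2 -nrm_star_mul nrmM.
Qed.

Lemma cmul_star_eq0 a : cstar a ** a = 0 -> a = 0.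
Proof.
move=> a0; apply: nrm0_eq0; apply/eqP.
by rewrite -sqrf_eq0 -nrm_star_mul a0 nrm0.
Qed.

(** The exponent is shifted, since there is no unit: [cpow a n] is the power
    [n + 1] of [a]. *)
Definition cpow a n : A := iter n (cmul a) a.

Lemma cpowS a n : cpow a n.+1 = a ** cpow a n.
Proof. by []. Qed.

Lemma cpowD a m n : cpow a m ** cpow a n = cpow a (m + n).+1.
Proof. by elim: m => //= m IH; rewrite -cmulA IH. Qed.

Lemma cpow_star a n : cstar a = a -> cstar (cpow a n) = cpow a n.
Proof.
move=> aE; elim: n => //= n IH.
by rewrite cstarM IH aE (cpowD a n 0) addn0.
Qed.

Lemma nrm_cpow_le a n : nrm (cpow a n) <= nrm a ^+ n.+1.
Proof.
elim: n => [|n IH]; first by rewrite expr1.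
by rewrite exprS (le_trans (nrmM _ _))// ler_wpM2l ?nrm_ge0.
Qed.

(** By the C*-identity the power [2 m] has the squared norm of the power [m];
    factoring it into the powers [m + 1] and [m - 1] carries the equality from
    [m] to [m + 1]. *)
Lemma nrm_cpow a n : cstar a = a -> nrm (cpow a n) = nrm a ^+ n.+1.
Proof.
move=> aE; elim: n => [|n IH]; first by rewrite expr1.
apply/eqP; rewrite eq_le nrm_cpow_le/=.
have [->|a0] := eqVneq (nrm a) 0; first by rewrite expr0n nrm_ge0.
have ap : 0 < nrm a by rewrite lt_def a0 nrm_ge0.
have sq : nrm (cpow a n) ^+ 2 = nrm (cpow a (n + n).+1).
  by rewrite -nrm_star_mul cpow_star// cpowD.
case: n IH sq => [_ |n IH] sq.
  by rewrite -sq.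
have e : cpow a (n.+1 + n.+1).+1 = cpow a n.+2 ** cpow a n.
  by rewrite cpowD; congr cpow; lia.
have : nrm (cpow a n.+1) ^+ 2 <= nrm (cpow a n.+2) * nrm a ^+ n.+1.
  rewrite sq e (le_trans (nrmM _ _))// ler_wpM2l ?nrm_ge0//.
  exact: nrm_cpow_le.
rewrite IH -exprM; have -> : (n.+2 * 2 = n.+3 + n.+1)%N by lia.
by rewrite exprD ler_pM2r ?exprn_gt0.
Qed.

(** Iterates the fixed-point form [c = (a^2 + c^2) / 2] of the equation
    [(1 - c)^2 = 1 - a^2]. *)
Fixpoint sqrt_iter a n : A :=
  if n is m.+1 then 2^-1 *: (a ** a + sqrt_iter a m ** sqrt_iter a m) else 0.

Lemma Re_half : complex.Re `|2^-1 : R[i]| = 2^-1 :> R.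
Proof.
rewrite ger0_norm ?invr_ge0//.
have -> : (2^-1 : R[i]) = (2^-1 : R)%:C%C by rewrite rmorphV ?unitfE// rmorph_nat.
by [].
Qed.

Lemma half_twice a : 2^-1 *: (a + a) = a.
Proof.
by rewrite -mulr2n -(scaler_nat 2 a) scalerA mulVf ?scale1r// pnatr_eq0.
Qed.

(** Without a unit, [c + c = a ** a + c ** c] says that [1 - c] is a square
    root of [1 - a^2].  On the ball of radius [nrm a < 1] the map
    [c |-> (a^2 + c^2) / 2] is a contraction with ratio [nrm a]. *)
Lemma sqrt_exists a : cstar a = a -> nrm a < 1 ->
  exists c, [/\ cstar c = c, c ** a = a ** c & c + c = a ** a + c ** c].
Proof.
move=> aE a1; pose c := sqrt_iter a; pose r := nrm a.
have r0 : 0 <= r by exact: nrm_ge0.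
have halfE x : nrm (2^-1 *: x : A) = 2^-1 * nrm x by rewrite nrmZ Re_half.
have cS n : c n.+1 = 2^-1 *: (a ** a + c n ** c n) by [].
have cE n : cstar (c n) = c n.
  elim: n => [|n IH]; first exact: cstar0.
  by rewrite cS cstarZ cstarD !cstarM IH aE fmorphV rmorph_nat.
have cC n : c n ** a = a ** c n.
  elim: n => [|n IH]; first by rewrite cmul0l cmul0r.
  by rewrite cS cmulZl cmulZr cmulDl cmulDr -!cmulA IH !cmulA IH.
have cr n : nrm (c n) <= r.
  elim: n => [|n IH]; first by rewrite nrm0.
  rewrite cS halfE.
  have h1 := nrmD (a ** a) (c n ** c n).
  have h2 := nrmM a a; have h3 := nrmM (c n) (c n).
  have h4 : nrm (c n) * nrm (c n) <= r * r by rewrite ler_pM ?nrm_ge0.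
  have h5 : r * r <= r * 1 by rewrite ler_wpM2l// ltW.
  rewrite -/r in h2; lra.
have step (u v : A) : nrm u <= r -> nrm v <= r ->
    nrm (2^-1 *: (a ** a + u ** u) - 2^-1 *: (a ** a + v ** v))
      <= r * nrm (u - v).
  move=> ur vr; rewrite -scalerBr halfE.
  have -> : a ** a + u ** u - (a ** a + v ** v) =
      u ** (u - v) + (u - v) ** v.
    by rewrite cmulBr cmulBl subrKA opprD addrACA subrr add0r.
  have h0 := nrmD (u ** (u - v)) ((u - v) ** v).
  have h1 := nrmM u (u - v); have h2 := nrmM (u - v) v.
  have h3 : nrm u * nrm (u - v) <= r * nrm (u - v) by rewrite ler_wpM2r ?nrm_ge0.
  have h4 : nrm (u - v) * nrm v <= nrm (u - v) * r by rewrite ler_wpM2l ?nrm_ge0.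
  lra.
have cdist n m : nrm (c (n + m)%N - c n) <= r ^+ n * r.
  elim: n => [|n IH]; first by rewrite expr0 mul1r subr0.
  rewrite addSn !cS (le_trans (step _ _ (cr _) (cr _)))//.
  by rewrite exprS -mulrA ler_wpM2l.
have [l Hl] : exists l, forall e : R, 0 < e -> exists N, forall n, (N <= n)%N ->
     nrm (c n - l) < e.
  apply: complete_seq => e e0.
  have [|N HN] := @expr_lt_eps _ r (e / 2) r0 a1; first lra.
  have K n : (N <= n)%N -> nrm (c n - c N) < e / 2.
    move=> /subnKC <-; apply: le_lt_trans (cdist _ _) _; apply: le_lt_trans HN.
    by rewrite -[leRHS]mulr1 ler_wpM2l ?exprn_ge0// ltW.
  exists N => m n /K h1 /K h2.
  have := nrm_dist (c m) (c N) (c n); rewrite (nrm_distC (c N)); lra.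
have lr : nrm l <= r.
  apply/ler_addgt0Pr => e /Hl [N /(_ N (leqnn N)) h].
  have := nrmD (l - c N) (c N); rewrite subrK nrm_distC.
  have := cr N; lra.
exists l; split.
- apply/eqP; rewrite -subr_eq0; apply/eqP; apply: nrm_lt_eq0 => e e0.
  have [|N /(_ N (leqnn N)) h] := Hl (e / 2); first lra.
  have := nrm_dist (cstar l) (c N) l.
  rewrite -{1}(cE N) -cstarB nrm_star (nrm_distC l); lra.
- apply/eqP; rewrite -subr_eq0; apply/eqP; apply: nrm_lt_eq0 => e e0.
  have [|N /(_ N (leqnn N)) h] := Hl (e / 2); first lra.
  have -> : l ** a - a ** l = (l - c N) ** a + a ** (c N - l).
    by rewrite cmulBl cmulBr cC addrA subrK.
  have h0 := nrmD ((l - c N) ** a) (a ** (c N - l)).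
  have h1 := nrmM (l - c N) a; have h2 := nrmM a (c N - l).
  have h3 : nrm (c N - l) * nrm a <= nrm (c N - l) * 1.
    by rewrite ler_wpM2l ?nrm_ge0// ltW.
  rewrite (nrm_distC l) in h1; lra.
- suff lE : l = 2^-1 *: (a ** a + l ** l).
    apply: (@scalerI _ _ (2^-1 : R[i])); first by rewrite invr_neq0// pnatr_eq0.
    by rewrite half_twice.
  apply/eqP; rewrite -subr_eq0; apply/eqP; apply: nrm_lt_eq0 => e e0.
  have [|N HN] := Hl (e / 2); first lra.
  have h1 := HN N.+1 (leqnSn _); have h2 := HN N (leqnn _).
  have := nrm_dist l (c N.+1) (2^-1 *: (a ** a + l ** l)).
  have := step _ _ (cr N) lr; rewrite -cS.
  have : r * nrm (c N - l) <= 1 * nrm (c N - l).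
    by rewrite ler_wpM2r ?nrm_ge0// ltW.
  rewrite (nrm_distC l (c N.+1)); lra.
Qed.

End CStarBasics.

(** * Star homomorphisms are contractive *)

Section StarHom.
Variables (R : realType) (A D : cstarAlgType R).

(** The hypotheses make [p + i (1 - d)] and [p - i (1 - d)] unitary in the
    unitization, and [p] is their mean.  Acting on [y] keeps the argument inside
    the algebra. *)
Lemma unitary_bound (p d y : D) : cstar p = p -> cstar d = d -> d ** p = p ** d ->
  d + d = p ** p + d ** d -> nrm (p ** y) <= nrm y.
Proof.
move=> pE dE dp dd; pose u := p ** y; pose v := y - d ** y.
have uv : cstar u ** v = cstar v ** u.
  rewrite /u /v cstarB !cstarM pE dE cmulBr cmulBl -!cmulA.
  by rewrite [p ** (d ** y)]cmulA -dp -cmulA.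
have uu : cstar u ** u + cstar v ** v = cstar y ** y.
  rewrite /u /v cstarB !cstarM pE dE cmulBr !cmulBl -!cmulA.
  have -> : p ** (p ** y) = d ** y + d ** y - d ** (d ** y).
    by rewrite !cmulA -cmulDl dd cmulDl addrK.
  by rewrite cmulBr cmulDr opprB addrCA subrKA addrK subrK.
have key (k : R[i]) : k^* = - k -> k ^+ 2 = -1 -> nrm (u + k *: v) = nrm y.
  move=> kc k2; apply: (@pexpIrn _ 2) => //; rewrite ?nnegrE ?nrm_ge0//.
  rewrite -!nrm_star_mul cstarD cstarZ kc.
  rewrite cmulDl !cmulDr !cmulZl !cmulZr uv scalerA mulNr -expr2 k2 opprK scale1r.
  by rewrite scaleNr -addrA addNKr uu.
have ki : nrm (u + 'i *: v) = nrm y by apply: key; rewrite ?conjCi ?sqrCi.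
have kNi : nrm (u + (- 'i) *: v) = nrm y.
  by apply: key; [rewrite rmorphN /= conjCi | rewrite sqrrN sqrCi].
have := nrmD (u + 'i *: v) (u + (- 'i) *: v).
rewrite ki kNi scaleNr addrACA subrr addr0.
have -> : u + u = 2 *: u by rewrite scaler_nat mulr2n.
rewrite nrmZ normr_nat -(rmorph_nat (real_complex R)) /=.
lra.
Qed.

(** A star homomorphism carries the square root of [1 - a^2] along, so that
    [f a] is the real part of a unitary. *)
Lemma star_hom_nrm_selfadj (f : A -> D) a : star_hom f -> cstar a = a ->
  nrm a < 1 -> nrm (f a) <= 1.
Proof.
move=> [fL fM fS] aE a1; have [c [cE ca cc]] := sqrt_exists aE a1.
have fD x y : f (x + y) = f x + f y.
  by rewrite -(scale1r x) fL !scale1r.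
have fpp := @unitary_bound (f a) (f c) (f a).
have [fa0|fa0] := eqVneq (nrm (f a)) 0; first by rewrite fa0.
have fap : 0 < nrm (f a) by rewrite lt_def fa0 nrm_ge0.
rewrite -(ler_pM2r fap) mul1r -expr2 -nrm_star_mul -fS aE; apply: fpp.
- by rewrite -fS aE.
- by rewrite -fS cE.
- by rewrite -!fM ca.
- by rewrite -fD cc fD !fM.
Qed.

Lemma star_hom_nrm (f : A -> D) a : star_hom f -> nrm (f a) <= nrm a.
Proof.
move=> fH; have [fL fM fS] := fH.
have fZ k x : f (k *: x) = k *: f x.
  have f0 : f 0 = 0.
    by have := fL (-1) 0 0; rewrite scaler0 addr0 scaleN1r addNr.
  by rewrite -(addr0 (k *: x)) fL f0 addr0.
suff sa h : cstar h = h -> nrm (f h) <= nrm h.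
  rewrite -(@ler_pXn2r _ 2)// ?nnegrE ?nrm_ge0// -!nrm_star_mul -fS -fM.
  by apply: sa; rewrite cstarM cstarK.
move=> hE; rewrite leNgt; apply/negP => hf.
(* rescale by a number strictly between the two norms *)
pose t : R := (nrm h + nrm (f h)) / 2.
have t0 : 0 < t by rewrite /t; have := nrm_ge0 h; lra.
have tC : complex.Re `|(t^-1)%:C%C : R[i]| = t^-1.
  by rewrite ger0_norm// lecR invr_ge0 ltW.
have := @star_hom_nrm_selfadj f ((t^-1)%:C%C *: h) fH.
rewrite fZ !nrmZ tC cstarZ hE.
rewrite mulrC ltr_pdivrMr// mul1r mulrC ler_pdivrMr// mul1r.
have -> : ((t^-1)%:C%C)^* = (t^-1)%:C%C :> R[i].
  by rewrite conj_Creal// complex_real.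
move=> /(_ erefl).
rewrite /t => H; have := H; lra.
Qed.
End StarHom.

(** * Extending partial star homomorphisms by continuity *)

Section Approximation.
Variables (R : realType) (A : cstarAlgType R).

Lemma approx_lin (k : R[i]) (a a' : A) (e : R) : 0 < e -> exists2 t, 0 < t &
  forall b b', nrm (a - b) < t -> nrm (a' - b') < t ->
    nrm (k *: a + a' - (k *: b + b')) < e.
Proof.
move=> e0; have k0 := Renorm_ge0 k; exists (e / (complex.Re `|k| + 1)).
  by rewrite divr_gt0//; lra.
move=> b b'; rewrite !ltr_pdivlMr; try lra.
rewrite opprD addrACA -scalerBr => h h'.
have h1 := nrmD (k *: (a - b)) (a' - b'); rewrite nrmZ in h1.
rewrite (le_lt_trans h1)// -(ltr_pM2r (_ : 0 < complex.Re `|k| + 1)); last lra.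
have h2 : complex.Re `|k| * (nrm (a - b) * (complex.Re `|k| + 1)) <= complex.Re `|k| * e.
  by rewrite ler_wpM2l// ltW.
lra.
Qed.

Lemma approx_mul (a a' : A) (e : R) : 0 < e -> exists2 t, 0 < t &
  forall b b', nrm (a - b) < t -> nrm (a' - b') < t ->
    nrm (a ** a' - b ** b') < e.
Proof.
move=> e0; have a0 := nrm_ge0 a; have a0' := nrm_ge0 a'.
set q := e / (nrm a + nrm a' + 1).
have q0 : 0 < q by rewrite divr_gt0//; lra.
have qE : q * (nrm a + nrm a' + 1) = e by rewrite divfK//; lra.
exists (Num.min 1 q) => [|b b']; first by rewrite lt_min ltr01.
rewrite !lt_min => /andP[b1 bq] /andP[b1' bq'].
have -> : a ** a' - b ** b' = (a - b) ** a' + b ** (a' - b').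
  by rewrite cmulBl cmulBr addrA subrK.
have h0 := nrmD ((a - b) ** a') (b ** (a' - b')).
have h1 := nrmM (a - b) a'; have h2 := nrmM b (a' - b').
have h3 : nrm b <= nrm a + 1.
  by have := nrmB a (a - b); rewrite subKr; lra.
have h4 : nrm (a - b) * nrm a' <= q * nrm a' by rewrite ler_wpM2r// ltW.
have h5 : nrm b * nrm (a' - b') <= (nrm a + 1) * nrm (a' - b').
  by rewrite ler_wpM2r ?nrm_ge0.
have h6 : (nrm a + 1) * nrm (a' - b') < (nrm a + 1) * q by rewrite ltr_pM2l//; lra.
lra.
Qed.

Lemma approx_star (a b : A) : nrm (cstar a - cstar b) = nrm (a - b).
Proof. by rewrite -cstarB nrm_star. Qed.

End Approximation.

(** A partial homomorphism is handled through its graph [T]: a set of pairs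
    closed under the operations, contractive from left to right, and with dense
    domain.  The closure of [T] is then the graph of a total map. *)
Section Extension.
Variables (R : realType) (A D : cstarAlgType R) (T : A -> D -> Prop).
Hypothesis TL : forall (k : R[i]) a d a' d', T a d -> T a' d' ->
  T (k *: a + a') (k *: d + d').
Hypothesis TM : forall a d a' d', T a d -> T a' d' -> T (a ** a') (d ** d').
Hypothesis TS : forall a d, T a d -> T (cstar a) (cstar d).
Hypothesis T_le : forall a d, T a d -> nrm d <= nrm a.
Hypothesis T_dense : forall a (e : R), 0 < e ->
  exists a' d', T a' d' /\ nrm (a - a') < e.

Definition graph_closure a d : Prop := forall e : R, 0 < e ->
  exists a' d', [/\ T a' d', nrm (a - a') < e & nrm (d - d') < e].

Lemma subset_graph_closure a d : T a d -> graph_closure a d.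
Proof. by move=> Tad e e0; exists a, d; rewrite !subrr !nrm0. Qed.

Lemma graph_closure_le a d : graph_closure a d -> nrm d <= nrm a.
Proof.
move=> H; apply/ler_addgt0Pr => e e0.
have [|a' [d' [/T_le Tb h1 h2]]] := H (e / 2); first lra.
have := nrmD (d - d') d'; have := nrmB a (a - a'); rewrite subrK subKr; lra.
Qed.

Lemma graph_closureL (k : R[i]) a d a' d' : graph_closure a d -> graph_closure a' d' ->
  graph_closure (k *: a + a') (k *: d + d').
Proof.
move=> H H' e e0.
have [t t0 Ht] := approx_lin k a a' e0; have [s s0 Hs] := approx_lin k d d' e0.
have m0 : 0 < Num.min t s by rewrite lt_min t0 s0.
have [b [c [Tbc]]] := H _ m0; rewrite !lt_min => /andP[? _] /andP[_ ?].
have [b' [c' [Tbc']]] := H' _ m0; rewrite !lt_min => /andP[? _] /andP[_ ?].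
exists (k *: b + b'), (k *: c + c'); split; [exact: TL|exact: Ht|exact: Hs].
Qed.

Lemma graph_closureM a d a' d' : graph_closure a d -> graph_closure a' d' ->
  graph_closure (a ** a') (d ** d').
Proof.
move=> H H' e e0.
have [t t0 Ht] := approx_mul a a' e0; have [s s0 Hs] := approx_mul d d' e0.
have m0 : 0 < Num.min t s by rewrite lt_min t0 s0.
have [b [c [Tbc]]] := H _ m0; rewrite !lt_min => /andP[? _] /andP[_ ?].
have [b' [c' [Tbc']]] := H' _ m0; rewrite !lt_min => /andP[? _] /andP[_ ?].
exists (b ** b'), (c ** c'); split; [exact: TM|exact: Ht|exact: Hs].
Qed.

Lemma graph_closure_star a d : graph_closure a d -> graph_closure (cstar a) (cstar d).
Proof.
move=> H e /H [b [c [Tbc h h']]]; exists (cstar b), (cstar c).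
by rewrite !approx_star; split=> //; exact: TS.
Qed.

Lemma graph_closure_fun a d d' : graph_closure a d -> graph_closure a d' -> d = d'.
Proof.
move=> H H'; apply/eqP; rewrite -subr_eq0; apply/eqP/nrm0_eq0/eqP.
rewrite eq_le nrm_ge0 andbT.
have := graph_closure_le (graph_closureL (-1) H H').
by rewrite !scaleN1r addNr nrm0 addrC nrm_distC.
Qed.

Lemma graph_closure_total a : exists d, graph_closure a d.
Proof.
have n0 n : 0 < n.+1%:R^-1 :> R by rewrite invr_gt0.
have /choice [u Hu] : forall n : nat, exists p : A * D,
    T p.1 p.2 /\ nrm (a - p.1) < n.+1%:R^-1.
  by move=> n; have [a' [d' H]] := T_dense a (n0 n); exists (a', d').
have sm e : 0 < e -> exists N, forall n, (N <= n)%N -> nrm (a - (u n).1) < e.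
  move=> e0; have := near_infty_natSinv_lt (PosNum e0) => -[N _ HN].
  exists N => n Nn; apply: lt_trans (Hu n).2 _; exact: (HN n Nn).
have ud m n : nrm ((u m).2 - (u n).2) <= nrm ((u m).1 - (u n).1).
  have := T_le (TL (-1) (Hu n).1 (Hu m).1).
  by rewrite !scaleN1r addrC [X in _ <= nrm X]addrC.
have [l Hl] : exists l, forall e : R, 0 < e -> exists N, forall n, (N <= n)%N ->
     nrm ((u n).2 - l) < e.
  apply: complete_seq => e e0; have [|N HN] := sm (e / 2); first lra.
  exists N => m n /HN h1 /HN h2; apply: le_lt_trans (ud m n) _.
  have := nrm_dist (u m).1 a (u n).1; rewrite (nrm_distC _ a); lra.
exists l => e e0; have [N HN] := sm e e0; have [M HM] := Hl e e0.
exists (u (maxn N M)).1, (u (maxn N M)).2; split.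
- exact: (Hu _).1.
- by apply: HN; exact: leq_maxl.
- by rewrite nrm_distC; apply: HM; exact: leq_maxr.
Qed.

Lemma star_hom_extension :
  exists f : A -> D, star_hom f /\ forall a d, T a d -> f a = d.
Proof.
have [f fP] := choice graph_closure_total; exists f; split; first split.
- by move=> k a b; apply: (graph_closure_fun (fP _)); apply: graph_closureL.
- by move=> a b; apply: (graph_closure_fun (fP _)); apply: graph_closureM.
- by move=> a; apply: (graph_closure_fun (fP _)); apply: graph_closure_star.
- by move=> a d /subset_graph_closure; apply: graph_closure_fun.
Qed.

End Extension.

(** * Generating sets *)

Section Equalizer.
Variables (R : realType) (A : cstarAlgType R).

Lemma sub_cstar_of (M : set A) : M 0 ->
  (forall (k : R[i]) u v, M u -> M v -> M (k *: u + v)) -> closed M ->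
  (forall a b, M a -> M b -> M (a ** b)) -> (forall a, M a -> M (cstar a)) ->
  exists C : sub_cstar A, cs_set C = M.
Proof.
move=> M0 ML Mc MM MS.
by exists (@SubCStar _ _ (ClosedSubspace (submodP M0 ML) Mc) (conj MM MS)).
Qed.

Variable (D : cstarAlgType R).

Lemma star_hom0 (f : A -> D) : star_hom f -> f 0 = 0.
Proof.
by case=> fL _ _; have := fL (-1) 0 0; rewrite scaler0 addr0 scaleN1r addNr.
Qed.

Lemma star_homB (f : A -> D) a b : star_hom f -> f (a - b) = f a - f b.
Proof.
by case=> fL _ _; have := fL (-1) b a; rewrite !scaleN1r ![- _ + _]addrC.
Qed.

Lemma star_hom_comp (B : cstarAlgType R) (g : D -> B) (f : A -> D) :
  star_hom f -> star_hom g -> star_hom (g \o f).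
Proof.
move=> [fL fM fS] [gL gM gS]; split.
- by move=> k a b /=; rewrite fL gL.
- by move=> a b /=; rewrite fM gM.
- by move=> a /=; rewrite fS gS.
Qed.

(** Contractivity makes the equalizer closed, hence a C*-subalgebra. *)
Lemma star_hom_eq (S : set A) (f g : A -> D) : generates S ->
  star_hom f -> star_hom g -> (forall a, S a -> f a = g a) -> f = g.
Proof.
move=> gS fH gH fg.
have [|||||C CE] := @sub_cstar_of [set a | f a = g a].
- by rewrite /= !star_hom0.
- by move=> k u v /= uE vE; case: fH gH => [-> _ _] [-> _ _]; rewrite uE vE.
- apply/closedP => a H /=.
  apply/eqP; rewrite -subr_eq0; apply/eqP/nrm_lt_eq0 => e e0.
  have [|b /= bE ab] := H (e / 2); first lra.
  have h1 := star_hom_nrm (a - b) fH; have h2 := star_hom_nrm (b - a) gH.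
  have := nrm_dist (f a) (f b) (g a).
  by rewrite {2}bE -!star_homB//; rewrite (nrm_distC b) in h2; lra.
- by move=> a b /= aE bE; case: fH gH => [_ -> _] [_ -> _]; rewrite aE bE.
- by move=> a /= aE; case: fH gH => [_ _ ->] [_ _ ->]; rewrite aE.
apply/funext => a; suff : cs_set C a by rewrite CE.
by rewrite gS// CE.
Qed.

End Equalizer.

(** * The correspondence of a graded algebra *)

Section GradedBasics.
Variables (R : realType) (A : cstarAlgType R) (G : zgrading A).
Local Notation gr := (gr G).
Local Notation A0 := (A0 G).
Local Notation A1 := (A1 G).

Lemma elt_in n (x : subspace_type (gr n)) : cs_set (gr n) (sub_val x).
Proof. by apply/set_mem; exact: sub_valP. Qed.

Lemma gr_elt n a : cs_set (gr n) a -> exists x : subspace_type (gr n), sub_val x = a.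
Proof. by move=> /mem_set an; exists (SubspaceElt a an). Qed.

Lemma gr_star_in n a : cs_set (gr n) a -> cs_set (gr (- n)) (cstar a).
Proof. by move=> an; rewrite gr_star; exists a. Qed.

Lemma gr_mul_in m n a b : cs_set (gr m) a -> cs_set (gr n) b ->
  cs_set (gr (m + n)) (a ** b).
Proof. by move=> am bn; apply: gr_mul; exists a, b. Qed.

(** Positivity of [x^* x] must be witnessed inside [A_0].  The conditional
    expectation does this: it is positive and fixes [x^* x]. *)
Lemma A1_correspondence : correspondence (A1_corr G).
Proof.
split; first split.
- by move=> x y b; apply: val_inj; apply: cmulDl.
- by move=> x a b; apply: val_inj; apply: cmulDr.
- by move=> k x b; apply: val_inj; apply: cmulZl.
- by move=> k x b; apply: val_inj; apply: cmulZr.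
- by move=> x a b; apply: val_inj; apply: cmulA.
- by move=> x k y z; apply: val_inj; rewrite /= cmulDr cmulZr.
- by move=> x y b; apply: val_inj; apply: cmulA.
- by move=> x y; apply: val_inj; rewrite /= cstarM cstarK.
- move=> x; have [E [_ Epos _ Eid _]] := gr_exp G.
  rewrite -(Eid (ip (A1_corr G) x x)); apply: Epos.
  by exists (sub_val x).
- move=> x /(congr1 (@sub_val _ _ _)) /= x0; apply: val_inj => /=.
  exact: cmul_star_eq0.
- by move=> x; apply/esym; exact: (cnorm_star (sub_val x : A)).
- by move=> k a b x; apply: val_inj; rewrite /= cmulDl cmulZl.
- by move=> a b x; apply: val_inj; rewrite /= cmulA.
- by move=> b x y; apply: val_inj; rewrite /= cstarM cmulA.
Qed.

(** With [w] the component of degree [j - N], the expectation sends [w^* a] to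
    [w^* w], because the other components contribute in non-zero degrees. *)
Lemma component_le N (u : int -> A) (j : 'I_(2 * N).+1) :
  (forall k, cs_set (gr k) (u k)) ->
  nrm (u (j%:Z - N%:Z)) <= nrm (\sum_(i < (2 * N).+1) u (i%:Z - N%:Z)).
Proof.
move=> ugr; set w := u (j%:Z - N%:Z); set a := \sum_(i < _) _.
have [E [Elin _ Ele Eid Ezero]] := gr_exp G.
have E0 : E 0 = 0 by have := Elin (-1) 0 0; rewrite scaler0 addr0 scaleN1r addNr.
have ED x y : E (x + y) = E x + E y.
  by have := Elin 1 x y; rewrite !scale1r.
have wa : E (cstar w ** a) = E (cstar w ** w).
  rewrite (big_morph _ (cmulDr (cstar w)) (cmul0r _)) (big_morph E ED E0).
  rewrite (bigD1 j)//= big1 ?addr0// => i ij.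
  apply: (Ezero (- (j%:Z - N%:Z) + (i%:Z - N%:Z))).
    by move: ij; rewrite -val_eqE/=; lia.
  by apply: gr_mul_in => //; exact: gr_star_in.
have ww : cs_set (gr 0) (cstar w ** w).
  have wj := ugr (j%:Z - N%:Z).
  by have := gr_mul_in (gr_star_in wj) wj; rewrite addNr.
have [b bE] := gr_elt ww.
have nE : nrm (E (cstar w ** w)) = nrm w ^+ 2.
  by rewrite -bE (Eid (b : A0)) -nrm_star_mul -bE.
have [w0|w0] := eqVneq (nrm w) 0; first by rewrite w0 nrm_ge0.
have wp : 0 < nrm w by rewrite lt_def w0 nrm_ge0.
rewrite -(ler_pM2l wp) -expr2 -nE -wa.
have h : nrm (E (cstar w ** a)) <= nrm (cstar w ** a).
  by rewrite -lecR -!nrmE; exact: Ele.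
by rewrite (le_trans h)// (le_trans (nrmM _ _))// nrm_star.
Qed.

Hypothesis Gs : strong G.

Lemma strong_approx m n a (e : R) : cs_set (gr (m + n)) a -> 0 < e ->
  exists2 b, lspan (mul_set (gr m) (gr n)) b & nrm (a - b) < e.
Proof. by rewrite -Gs => /closureP; apply. Qed.

Lemma A1_full : full (A1_corr G).
Proof.
apply/seteqP; split=> // b _; apply/closureP => e e0.
have b0 : cs_set (gr (-1 + 1)) (sub_val b) by rewrite addNr; exact: elt_in.
have [c Sc bc] := strong_approx b0 e0.
suff [c' Sc' cE] : exists2 c' : A0,
    lspan [set b | exists x y, b = ip (A1_corr G) x y] c' & sub_val c' = c.
  by exists c' => //; rewrite -cE in bc.
move: c Sc {bc}; apply: lspan_sub.
- by exists 0 => //; exact: lspan0.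
- move=> k u v [u' Su <-] [v' Sv <-].
  by exists (k *: u' + v') => //; exact: lspanL.
- move=> _ [x [y [xm yn ->]]].
  have [x' x'E] := gr_elt (gr_star_in xm); have [y' y'E] := gr_elt yn.
  exists (ip (A1_corr G) x' y'); first by apply: lspan_gen; exists x', y'.
  by rewrite /= x'E y'E cstarK.
Qed.

(** By strength, [a^*] is a limit of sums of elements of [A_1 A_(- n - 1)], all
    of which [a] annihilates; hence [a a^* = 0]. *)
Lemma annihilates_A1_eq0 a n : cs_set (gr n) a ->
  (forall x, cs_set (gr 1) x -> a ** x = 0) -> a = 0.
Proof.
move=> an ax; rewrite -(cstarK a); suff -> : cstar a = 0 by rewrite cstar0.
apply: cmul_star_eq0; rewrite cstarK.
apply: nrm_lt_eq0 => e e0.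
have a0 := nrm_ge0 a.
have an' : cs_set (gr (1 + (- n - 1))) (cstar a) by rewrite subrKC; exact: gr_star_in.
have [|b Sb ab] := strong_approx (e := e / (nrm a + 1)) an'.
  by rewrite divr_gt0//; lra.
have ab0 : a ** b = 0.
  move: b Sb {ab}; apply: lspan_sub.
  - exact: cmul0r.
  - by move=> k u v /= u0 v0; rewrite cmulDr cmulZr u0 v0 scaler0 addr0.
  - by move=> _ [x [y [x1 _ ->]]] /=; rewrite cmulA ax// cmul0l.
have -> : a ** cstar a = a ** (cstar a - b) by rewrite cmulBr ab0 subr0.
have h := nrmM a (cstar a - b).
have h2 : nrm a * nrm (cstar a - b) <= nrm a * (e / (nrm a + 1)).
  by rewrite ler_wpM2l// ltW.
have h3 : nrm a * (e / (nrm a + 1)) <= e.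
  rewrite mulrA ler_pdivrMr; last lra.
  by rewrite mulrC ler_pM2l//; lra.
lra.
Qed.

Lemma lact_inj : injective_left_action (A1_corr G).
Proof.
move=> a b ab; apply: val_inj; apply/eqP; rewrite -subr_eq0; apply/eqP.
apply: (@annihilates_A1_eq0 _ 0).
  by have := elt_in (a - b).
move=> x /gr_elt [x' <-]; rewrite cmulBl; apply/eqP; rewrite subr_eq0; apply/eqP.
by have := congr1 (fun f => sub_val (f x')) ab.
Qed.

Fact outer_subproof (x y : A1) :
  (sub_val x : A) ** cstar (sub_val y) \in cs_set (gr 0).
Proof.
apply: (@gr_mulP _ _ _ 1 (-1)); first exact: sub_valP.
by apply/mem_set; apply: gr_star_in; exact: elt_in.
Qed.
Definition outer (x y : A1) : A0 := SubspaceElt _ (outer_subproof x y).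

(** The operator [theta x y] is left multiplication by [x y^*], an element of
    [A_0].  This identity drives compactness of the left action, the description
    of all compact operators, and the use of covariance. *)
Lemma theta_lact x y : theta (A1_corr G) x y = lact (A1_corr G) (outer x y).
Proof. by apply/funext => z; apply: val_inj; rewrite /= cmulA. Qed.

Lemma lactL (k : R[i]) (a b : A0) : lact (A1_corr G) (k *: a + b) =
  k *: lact (A1_corr G) a + lact (A1_corr G) b.
Proof.
by apply/funext => z; apply: val_inj; rewrite /= cmulDl cmulZl.
Qed.

Lemma lact_adjointable b : adjointable (A1_corr G) (lact (A1_corr G) b).
Proof.
exists (lact (A1_corr G) (cstar b)); exact: lact_adjoint A1_correspondence b.
Qed.

Lemma A1_compact : compact_left_action (A1_corr G).
Proof.
move=> b; split; first exact: lact_adjointable.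
move=> e e0; have eE : e = (complex.Re e)%:C%C by rewrite RRe_real// gtr0_real.
have e0' : 0 < complex.Re e by rewrite -ltcR -eE.
have b0 : cs_set (gr (1 + -1)) (sub_val b) by rewrite subrr; exact: elt_in.
have [c Sc bc] := strong_approx b0 e0'.
suff [c' Fc' cE] : exists2 c' : A0, finite_rank (A1_corr G) (lact (A1_corr G) c')
    & sub_val c' = c.
  exists (lact (A1_corr G) c') => // z.
  rewrite !nrmE eE -rmorphM lecR.
  have -> : nrm (lact (A1_corr G) b z - lact (A1_corr G) c' z) =
      nrm ((sub_val b - sub_val c' : A) ** sub_val z).
    by rewrite cmulBl.
  apply: le_trans (nrmM _ _) _; rewrite cE.
  by apply: ler_wpM2r; [exact: nrm_ge0|exact: ltW].
move: c Sc {bc}; apply: lspan_sub.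
- exists 0 => //; have -> : lact (A1_corr G) 0 = 0.
    by apply/funext => z; apply: val_inj; exact: cmul0l.
  exact: lspan0.
- move=> k u v [u' Su <-] [v' Sv <-].
  by exists (k *: u' + v') => //; rewrite lactL; exact: lspanL.
- move=> _ [x [y [xm yn ->]]].
  have [x' x'E] := gr_elt xm; have [y' y'E] := gr_elt (gr_star_in yn).
  exists (outer x' y'); last by rewrite /= x'E y'E cstarK.
  by rewrite -theta_lact; apply: lspan_gen; exists x', y'.
Qed.

(** Any [w] in the span of [A_1 A_(-1)] satisfies [nrm (k^n w) <= C M^n] for
    some [C].  By strength [k] itself is close to such a [w], so that [nrm k ^ n]
    is at most a constant multiple of [M ^ n]. *)
Lemma lact_norm_selfadj (k : A) (M : R) : cs_set (gr 0) k -> cstar k = k ->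
  0 <= M -> (forall z, cs_set (gr 1) z -> nrm (k ** z) <= M * nrm z) ->
  nrm k <= M.
Proof.
move=> k0 kE M0 kM.
have [kn|kn] := eqVneq (nrm k) 0; first by rewrite kn.
have kp : 0 < nrm k by rewrite lt_def kn nrm_ge0.
have powM n z : cs_set (gr 1) z ->
    cs_set (gr 1) (cpow k n ** z) /\ nrm (cpow k n ** z) <= M ^+ n.+1 * nrm z.
  elim: n => [|n IH] z1.
    by rewrite expr1 kM//; split=> //; have := gr_mul_in k0 z1; rewrite add0r.
  have [kz le] := IH z1; rewrite cpowS -cmulA; split.
    by have := gr_mul_in k0 kz; rewrite add0r.
  by rewrite exprS -mulrA (le_trans (kM _ kz))// ler_wpM2l.
have k2 : 0 < nrm k / 2 by lra.
have k0' : cs_set (gr (1 + -1)) k by rewrite subrr.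
have [w Sw kw] := strong_approx k0' k2.
have [C HC] : exists C, forall n, nrm (cpow k n ** w) <= C * M ^+ n.+1.
  move: w Sw {kw}; apply: lspan_sub.
  - by exists 0 => n; rewrite cmul0r nrm0 mul0r.
  - move=> l u v [C HC] [C' HC'].
    exists (complex.Re `|l| * C + C') => n.
    rewrite cmulDr cmulZr (le_trans (nrmD _ _))// nrmZ mulrDl lerD// -mulrA.
    by rewrite ler_wpM2l// Renorm_ge0.
  - move=> _ [x [y [xm yn ->]]]; exists (nrm x * nrm y) => n.
    have [_ h] := powM n x xm; rewrite cmulA (le_trans (nrmM _ _))//.
    by rewrite (le_trans (ler_wpM2r (nrm_ge0 y) h))// [leRHS]mulrC mulrA.
apply: (@expr_growth _ _ _ 0 (2 * C / nrm k)) => //; first exact: nrm_ge0.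
move=> n; rewrite mul0r add0r.
have h1 := nrmM (cpow k n) (k - w).
have h2 : nrm (cpow k n) * nrm (k - w) <= nrm k ^+ n.+1 * (nrm k / 2).
  by rewrite ler_pM ?nrm_ge0 ?nrm_cpow_le// ltW.
have h3 := nrmD (cpow k n ** (k - w)) (cpow k n ** w).
have h4 := HC n.
move: h3; rewrite -cmulDr subrK (cpowD k n 0) addn0 nrm_cpow// => h3.
have h5 : nrm k ^+ n.+2 = nrm k ^+ n.+1 * nrm k by rewrite exprSr.
rewrite mulrAC ler_pdivlMr// h5 in h3 *.
lra.
Qed.

(** The left action is bounded below by the norm of [A_0]; this is what makes
    its range closed among the operators on [A_1]. *)
Lemma lact_norm (b : A0) (M : R) :
  0 <= M -> (forall z, nrm (lact (A1_corr G) b z) <= M * nrm z) ->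
  nrm b <= M.
Proof.
move=> M0 bM; pose a : A := sub_val b.
have a0 : cs_set (gr 0) a by exact: elt_in.
have a0' : cs_set (gr 0) (cstar a) by have := gr_star_in a0; rewrite oppr0.
have aM z : cs_set (gr 1) z -> nrm (a ** z) <= M * nrm z.
  by move=> /gr_elt [z' <-]; exact: bM.
rewrite -(@ler_pXn2r _ 2)// ?nnegrE ?nrm_ge0//.
have -> : nrm b = nrm a by [].
rewrite -nrm_star_mul; apply: lact_norm_selfadj.
- by have := gr_mul_in a0' a0; rewrite addr0.
- by rewrite cstarM cstarK.
- by rewrite exprn_ge0.
move=> z z1.
have saM y : cs_set (gr 1) y -> nrm (cstar a ** y) <= M * nrm y.
  move=> y1; have [e|e] := eqVneq (nrm (cstar a ** y)) 0.
    by rewrite e mulr_ge0 ?nrm_ge0.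
  have ep : 0 < nrm (cstar a ** y) by rewrite lt_def e nrm_ge0.
  rewrite -(ler_pM2r ep) -expr2 -nrm_star_mul cstarM cstarK.
  have ay1 : cs_set (gr 1) (cstar a ** y).
    by have := gr_mul_in a0' y1; rewrite add0r.
  have h := ler_wpM2l (nrm_ge0 y) (aM _ ay1).
  rewrite -cmulA (le_trans (nrmM _ _))// nrm_star (le_trans h)//.
  by rewrite mulrCA mulrA.
have az1 : cs_set (gr 1) (a ** z) by have := gr_mul_in a0 z1; rewrite add0r.
rewrite -cmulA (le_trans (saM _ az1))// expr2 -mulrA ler_wpM2l//.
exact: aM.
Qed.

Lemma finite_rank_lact F : finite_rank (A1_corr G) F ->
  exists b : A0, F = lact (A1_corr G) b.
Proof.
move: F; apply: lspan_sub.
- by exists 0; apply/funext => z; apply: val_inj; rewrite /= cmul0l.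
- by move=> k _ _ [a ->] [b ->]; exists (k *: a + b); rewrite lactL.
- by move=> _ [x [y ->]]; exists (outer x y); exact: theta_lact.
Qed.

End GradedBasics.

(** * The inclusions form a covariant representation *)

Section CanonicalRep.
Variables (R : realType) (A : cstarAlgType R) (G : zgrading A).
Local Notation gr := (gr G).
Local Notation A0 := (A0 G).
Local Notation A1 := (A1 G).
Hypothesis Gs : strong G.

Definition val0 (b : A0) : A := sub_val b.
Definition val1 (x : A1) : A := sub_val x.

Lemma lactB (a b : A0) z : lact (A1_corr G) (a - b) z =
  lact (A1_corr G) a z - lact (A1_corr G) b z.
Proof. by apply: val_inj; exact: cmulBl. Qed.

(** Finite-rank approximations of [T] are left multiplications by some [u n] in
    [A_0]; the lower bound for the left action makes [u] a Cauchy sequence. *)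
Lemma compact_lact T : compact_op (A1_corr G) T ->
  exists b : A0, T = lact (A1_corr G) b.
Proof.
move=> [_ Tc].
have Tc' (e : R) : 0 < e -> exists b : A0, forall z,
    nrm (T z - lact (A1_corr G) b z) <= e * nrm z.
  move=> e0; have [|F /finite_rank_lact [b ->] H] := Tc (e%:C%C).
    by rewrite ltcR.
  by exists b => z; have := H z; rewrite !nrmE -rmorphM lecR.
have /choice [u Hu] n := Tc' _ (inv_succ_gt0 _ n).
have [l Hl] : exists l, forall e : R, 0 < e -> exists N, forall n, (N <= n)%N ->
     nrm (u n - l) < e.
  apply: complete_seq => e e0.
  have [|N HN] := @inv_succ_small _ (e / 2); first lra.
  exists N => m n /HN Nm /HN Nn.
  apply: (@le_lt_trans _ _ (m.+1%:R^-1 + n.+1%:R^-1)); last by rewrite (splitr e) ltrD.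
  apply: lact_norm => // z.
  have h := nrm_dist (lact (A1_corr G) (u m) z) (T z) (lact (A1_corr G) (u n) z).
  rewrite lactB (le_trans h)// mulrDl; apply: lerD; last exact: Hu.
  by rewrite nrm_distC; exact: Hu.
exists l; apply/funext => z; apply/eqP; rewrite -subr_eq0; apply/eqP.
apply: nrm_lt_eq0 => e e0; have z0 := nrm_ge0 z.
set d := e / (2 * (nrm z + 1)).
have d0 : 0 < d by rewrite divr_gt0//; lra.
have dE : d * (2 * (nrm z + 1)) = e by rewrite divfK//; lra.
have [N HN] := @inv_succ_small _ d d0; have [M HM] := Hl d d0.
set n := maxn N M; have nN := HN n (leq_maxl _ _); have nM := HM n (leq_maxr _ _).
have := nrm_dist (T z) (lact (A1_corr G) (u n) z) (lact (A1_corr G) l z).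
rewrite -lactB; have h1 := Hu n z.
have h2 : nrm (lact (A1_corr G) (u n - l) z) <= nrm (u n - l) * nrm z.
  exact: nrmM.
have h3 : nrm (u n - l) * nrm z <= d * nrm z by rewrite ler_wpM2r// ltW.
have h4 : n.+1%:R^-1 * nrm z <= d * nrm z by rewrite ler_wpM2r// ltW.
move: (n.+1%:R^-1) h1 h4 => q h1 h4 h5. lra.
Qed.

Lemma lact_adjointE (a b : A0) :
  adjoint_of (A1_corr G) (lact (A1_corr G) a) (lact (A1_corr G) b) ->
  b = cstar a.
Proof.
move=> ab; apply: (lact_inj Gs); apply/funext => y.
apply/eqP; rewrite -subr_eq0; apply/eqP.
apply: (ip_eq0 (corr_hilbert (A1_correspondence G))).
set x := _ - _.
have H : ip (A1_corr G) x (lact (A1_corr G) b y) =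
    ip (A1_corr G) x (lact (A1_corr G) (cstar a) y).
  by rewrite -ab (lact_adjoint (A1_correspondence G)).
have ipB u v : ip (A1_corr G) x (u - v) = ip (A1_corr G) x u - ip (A1_corr G) x v.
  by apply: val_inj; exact: cmulBr.
by rewrite {2}/x ipB H subrr.
Qed.

(** The left action identifies [A_0] with the compact operators, and the
    induced map is the inverse of this identification. *)
Lemma val_covariant : covariant_representation (A1_corr G) val0 val1.
Proof.
split; first by split=> //; split.
have /choice [f fP] : forall T : A1 -> A1, exists a : A,
    forall b : A0, T = lact (A1_corr G) b -> a = sub_val b.
  move=> T; have [[b ->]|nb] := pselect (exists b, T = lact (A1_corr G) b).
    by exists (sub_val b) => b' /(lact_inj Gs) ->.
  by exists 0 => b Tb; case: nb; exists b.
have fE b : f (lact (A1_corr G) b) = sub_val b by exact: fP.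
exists f => //; split.
- by move=> k _ _ /compact_lact [a ->] /compact_lact [b ->]; rewrite -lactL !fE.
- move=> _ _ /compact_lact [a ->] /compact_lact [b ->].
  rewrite !fE; have -> : lact (A1_corr G) a \o lact (A1_corr G) b =
    lact (A1_corr G) (a ** b).
    by apply/funext => z; apply: val_inj; rewrite /= cmulA.
  by rewrite fE.
- move=> _ _ /compact_lact [a ->] /compact_lact [b ->] /lact_adjointE ->.
  by rewrite !fE.
- by move=> x y; rewrite theta_lact fE.
Qed.

(** Strength reaches the degree [n + 1] from [A_1] and [A_n], and adjoints
    reach the negative degrees. *)
Lemma A0_A1_generate : generates (range val0 `|` range val1).
Proof.
move=> C SC.
have C0 : cs_set (gr 0) `<=` C.
  by move=> a /gr_elt [b <-]; apply: SC; left; exists b.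
have C1 : cs_set (gr 1) `<=` C.
  by move=> a /gr_elt [b <-]; apply: SC; right; exists b.
have [CM CS] := sc_closed C.
have Cn (n : nat) : cs_set (gr n) `<=` C.
  elim: n => [//|n IH]; rewrite intS -Gs; apply: closed_span_sub.
  - exact: subspace0.
  - by move=> k u v; exact: subspaceL.
  - exact: cs_closed.
  - by move=> _ [x [y [/C1 ? /IH ? ->]]]; exact: CM.
have Cz n : cs_set (gr n) `<=` C.
  case: n => [n|n]; first exact: Cn.
  move=> a /gr_star_in; rewrite NegzE opprK => /Cn/CS.
  by rewrite cstarK.
apply/seteqP; split=> // a _.
have : closed_span (\bigcup_n cs_set (gr n)) a by rewrite gr_dense.
apply: closed_span_sub.
- exact: subspace0.
- by move=> k u v; exact: subspaceL.
- exact: cs_closed.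
- by move=> b [n _ bn]; exact: Cz bn.
Qed.

End CanonicalRep.

Lemma dense_of_generates (R : realType) (A : cstarAlgType R) (S M : set A) :
  generates S -> S `<=` M -> M 0 ->
  (forall (k : R[i]) u v, M u -> M v -> M (k *: u + v)) ->
  (forall a b, M a -> M b -> M (a ** b)) -> (forall a, M a -> M (cstar a)) ->
  closure M = setT.
Proof.
move=> gS SM M0 ML MM MS.
have cl a : M a -> closure M a by move=> Ma; exact: subset_closure.
have [|||||C CE] := @sub_cstar_of _ _ (closure M).
- exact: cl.
- move=> k u v /closureP uM /closureP vM; apply/closureP => e e0.
  have [t t0 Ht] := approx_lin k u v e0.
  have [u' Mu' h] := uM t t0; have [v' Mv' h'] := vM t t0.
  by exists (k *: u' + v'); [exact: ML|exact: Ht].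
- exact: closed_closure.
- move=> u v /closureP uM /closureP vM; apply/closureP => e e0.
  have [t t0 Ht] := approx_mul u v e0.
  have [u' Mu' h] := uM t t0; have [v' Mv' h'] := vM t t0.
  by exists (u' ** v'); [exact: MM|exact: Ht].
- move=> u /closureP uM; apply/closureP => e /uM [u' Mu' h].
  by exists (cstar u'); [exact: MS|rewrite approx_star].
by rewrite -CE; apply: gS => a /SM /cl; rewrite CE.
Qed.

(** * The universal property *)

Section Universal.
Variables (R : realType) (A : cstarAlgType R) (G : zgrading A).
Local Notation gr := (gr G).
Local Notation A0 := (A0 G).
Local Notation A1 := (A1 G).
Variables (D : cstarAlgType R) (pi : A0 -> D) (psi : A1 -> D).
Hypothesis cov : covariant_representation (A1_corr G) pi psi.

Let piH : star_hom pi. Proof. by have [[]] := cov. Qed.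
Let psi_lact b x : psi (lact (A1_corr G) b x) = pi b ** psi x.
Proof. by have [[]] := cov. Qed.
Let psi_ract x b : psi (ract (A1_corr G) x b) = psi x ** pi b.
Proof. by have [[]] := cov. Qed.
Let psi_ip x y : cstar (psi x) ** psi y = pi (ip (A1_corr G) x y).
Proof. by have [[]] := cov. Qed.

(** The only use of covariance: it turns [psi x psi(y)^*], which for a mere
    representation lies in the image of the compact operators, into a value of
    [pi]. *)
Lemma psi_outer x y : psi x ** cstar (psi y) = pi (outer x y).
Proof.
have [_ [psi1 [_ _ _ psi1E] psi1pi]] := cov.
by rewrite -psi1E theta_lact psi1pi.
Qed.

Let piM a b : pi (a ** b) = pi a ** pi b. Proof. by case: piH. Qed.
Let piS a : pi (cstar a) = cstar (pi a). Proof. by case: piH. Qed.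
Let piL (k : R[i]) a b : pi (k *: a + b) = k *: pi a + pi b.
Proof. by case: piH => H _ _; exact: H. Qed.

(** The graph, in degree [n], of the map sending [x_1 ... x_n b] to
    [psi x_1 ... psi x_n pi b], before it is known that there is such a map.  The
    separate constructor for [x] is there because [x] need not be of the form
    [y b]. *)
Inductive pos_pair : nat -> A -> D -> Prop :=
| pos_pair0 (b : A0) : pos_pair 0 (sub_val b) (pi b)
| pos_pair1 (x : A1) : pos_pair 1 (sub_val x) (psi x)
| pos_pairS n (x : A1) a d : pos_pair n a d -> pos_pair n.+1 (sub_val x ** a) (psi x ** d)
| pos_pairL n (k : R[i]) a d a' d' : pos_pair n a d -> pos_pair n a' d' ->
    pos_pair n (k *: a + a') (k *: d + d').

Lemma pos_pair_zero n : pos_pair n 0 0.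
Proof.
elim: n => [|n IH].
  by have := pos_pair0 0; rewrite (star_hom0 piH).
by have := pos_pairS 0 IH; rewrite !cmul0r.
Qed.

Lemma pos_pair0_inv a d : pos_pair 0 a d -> exists2 b : A0, a = sub_val b & d = pi b.
Proof.
have H n : pos_pair n a d -> n = 0%N -> exists2 b : A0, a = sub_val b & d = pi b.
  elim=> {n a d} [b _|//|//|n k a d a' d' _ IH _ IH' n0].
    by exists b.
  have [b -> ->] := IH n0; have [b' -> ->] := IH' n0.
  by exists (k *: b + b') => //; rewrite piL.
by move=> /H; apply.
Qed.

Lemma pos_pair_gr n a d : pos_pair n a d -> cs_set (gr n) a.
Proof.
elim=> {n a d} [b|x|n x a d _ IH|n k a d a' d' _ IH _ IH'].
- exact: elt_in.
- exact: elt_in.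
- by rewrite intS; apply: gr_mul_in => //; exact: elt_in.
- exact: subspaceL.
Qed.

Lemma pos_pair_mul0l (b : A0) n a d : pos_pair n a d ->
  pos_pair n (sub_val b ** a) (pi b ** d).
Proof.
move=> H; elim: H b => {n a d} [b' b|x b|n x a d w _ b|n k a d a' d' _ IH _ IH' b].
- by rewrite -piM; exact: (pos_pair0 (b ** b')).
- by rewrite -psi_lact; exact: (pos_pair1 (lact (A1_corr G) b x)).
- by rewrite !cmulA -psi_lact; exact: (pos_pairS (lact (A1_corr G) b x) w).
- by rewrite !cmulDr !cmulZr; apply: pos_pairL.
Qed.

Lemma pos_pair_mul0r (b : A0) n a d : pos_pair n a d ->
  pos_pair n (a ** sub_val b) (d ** pi b).
Proof.
elim=> {n a d} [b'|x|n x a d _ IH|n k a d a' d' _ IH _ IH'].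
- by rewrite -piM; exact: (pos_pair0 (b' ** b)).
- by rewrite -psi_ract; exact: (pos_pair1 (ract (A1_corr G) x b)).
- by rewrite -!cmulA; exact: pos_pairS.
- by rewrite !cmulDl !cmulZl; exact: pos_pairL.
Qed.

Lemma pos_pair_mul m n a d a' d' : pos_pair m a d -> pos_pair n a' d' ->
  pos_pair (m + n) (a ** a') (d ** d').
Proof.
move=> H H'; elim: H => {m a d} [b|x|m x a d _ IH|m k a1 d1 a2 d2 _ IH _ IH'].
- exact: pos_pair_mul0l.
- exact: pos_pairS.
- by rewrite -!cmulA addSn; exact: pos_pairS.
- by rewrite !cmulDl !cmulZl; exact: pos_pairL.
Qed.

(** Multiplying by adjoints cancels letters: on the left by the inner product,
    on the right ([pos_pair_lower_r]) by covariance. *)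
Lemma pos_pair_lower_l n a d (x : A1) : pos_pair n.+1 a d ->
  pos_pair n (cstar (sub_val x) ** a) (cstar (psi x) ** d).
Proof.
have H m : pos_pair m a d -> m = n.+1 ->
    pos_pair n (cstar (sub_val x) ** a) (cstar (psi x) ** d).
  elim=> {m a d} [//|y [<-]|m y a d w _ [<-]|m k a d a' d' _ IH _ IH' mE].
    by rewrite psi_ip; exact: (pos_pair0 (ip (A1_corr G) x y)).
    by rewrite !cmulA psi_ip; exact: (pos_pair_mul0l (ip (A1_corr G) x y) w).
  by rewrite !cmulDr !cmulZr; apply: pos_pairL; auto.
by move=> /H; apply.
Qed.

Lemma pos_pair_lower_r n a d (x : A1) : pos_pair n.+1 a d ->
  pos_pair n (a ** cstar (sub_val x)) (d ** cstar (psi x)).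
Proof.
have H m : pos_pair m a d -> forall n, m = n.+1 ->
    pos_pair n (a ** cstar (sub_val x)) (d ** cstar (psi x)).
  elim=> {m a d n} [//|y n [<-]|m y a d w IH n [mn]|m k a d a' d' _ IH _ IH' n mE].
    by rewrite psi_outer; exact: (pos_pair0 (outer y x)).
    rewrite -mn -!cmulA; case: m w IH mn => [|m] w IH mn; last first.
      by apply: pos_pairS; exact: IH.
    have [b -> ->] := pos_pair0_inv w.
    (* one letter followed by [b]: move [b] across to the letter [x] *)
    pose xb := ract (A1_corr G) x (cstar b).
    have -> : psi y ** (pi b ** cstar (psi x)) = pi (outer y xb).
      by rewrite -psi_outer psi_ract cstarM piS cstarK.
    have -> : sub_val y ** (sub_val b ** cstar (sub_val x)) = sub_val (outer y xb) :> A.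
      by rewrite /= cstarM cstarK.
    exact: pos_pair0.
  by rewrite !cmulDl !cmulZl; apply: pos_pairL; auto.
by move=> /H; apply.
Qed.

Lemma pos_pair_star_mul n m a d a' d' : pos_pair n a d -> pos_pair (n + m) a' d' ->
  pos_pair m (cstar a ** a') (cstar d ** d').
Proof.
move=> H; elim: H a' d' => {n a d}
  [b|x|n x a d _ IH|n k a1 d1 a2 d2 _ IH _ IH'] a' d' w.
- by rewrite -piS; exact: (pos_pair_mul0l (cstar b) w).
- exact: pos_pair_lower_l.
- by rewrite !cstarM -!cmulA; apply: IH; exact: pos_pair_lower_l.
- by rewrite !cstarL !cmulDl !cmulZl; apply: pos_pairL; auto.
Qed.

Lemma pos_pair_mul_star n m a d a' d' : pos_pair n a d -> pos_pair (n + m) a' d' ->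
  pos_pair m (a' ** cstar a) (d' ** cstar d).
Proof.
move=> H; elim: H m a' d' => {n a d}
  [b|x|n x a d _ IH|n k a1 d1 a2 d2 _ IH _ IH'] m a' d' w.
- by rewrite -piS; exact: (pos_pair_mul0r (cstar b) w).
- exact: pos_pair_lower_r.
- rewrite !cstarM !cmulA; apply: pos_pair_lower_r; apply: IH.
  by rewrite addnS.
- by rewrite !cstarL !cmulDr !cmulZr; apply: pos_pairL; auto.
Qed.

Definition graded_pair (k : int) (a : A) (d : D) : Prop :=
  match k with
  | Posz n => pos_pair n a d
  | Negz n => pos_pair n.+1 (cstar a) (cstar d)
  end.

Lemma graded_pair_neg (n : nat) a d : pos_pair n (cstar a) (cstar d) ->
  graded_pair (- n%:Z) a d.
Proof.
case: n => [|n] //= /pos_pair0_inv [b aE dE].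
have := pos_pair0 (cstar b); rewrite piS -dE cstarK.
by have -> : sub_val (cstar b) = a by rewrite /= -aE cstarK.
Qed.

Lemma graded_pair_negV (n : nat) a d : graded_pair (- n%:Z) a d ->
  pos_pair n (cstar a) (cstar d).
Proof.
case: n => [|n] //= /pos_pair0_inv [b aE dE].
by rewrite aE dE -piS; exact: (pos_pair0 (cstar b)).
Qed.

Lemma graded_pair_star k a d : graded_pair k a d ->
  graded_pair (- k) (cstar a) (cstar d).
Proof.
case: k => n H; last by rewrite NegzE opprK.
by apply: graded_pair_neg; rewrite !cstarK.
Qed.

Lemma graded_pair0 k : graded_pair k 0 0.
Proof. by case: k => n /=; rewrite ?cstar0; exact: pos_pair_zero. Qed.

Lemma graded_pairL k (l : R[i]) a d a' d' :
  graded_pair k a d -> graded_pair k a' d' ->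
  graded_pair k (l *: a + a') (l *: d + d').
Proof.
case: k => n /=; first exact: pos_pairL.
by rewrite !cstarL; exact: pos_pairL.
Qed.

Lemma graded_pair_gr k a d : graded_pair k a d -> cs_set (gr k) a.
Proof.
case: k => n /= /pos_pair_gr // /gr_star_in.
by rewrite cstarK -NegzE.
Qed.

(** For degrees of opposite signs the letters of the shorter factor cancel against
    those of the longer one; a product of negative degree is treated through its
    adjoint. *)
Lemma graded_pairM k l a d a' d' : graded_pair k a d -> graded_pair l a' d' ->
  graded_pair (k + l) (a ** a') (d ** d').
Proof.
have int_case (i : int) : exists n : nat, i = n \/ i = - n%:Z.
  by case: i => n; [exists n; left|exists n.+1; right; rewrite NegzE].
have [m [->|->]] := int_case k; have [n [->|->]] := int_case l.
- exact: pos_pair_mul.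
- move=> w /graded_pair_negV w'; have [nm|mn] := leqP n m.
    rewrite -(cstarK a') -(cstarK d') -(subnKC nm) PoszD addrAC subrr add0r /=.
    by apply: pos_pair_mul_star w' _; rewrite subnKC.
  rewrite -(subnKC (ltnW mn)) PoszD opprD addrA subrr add0r.
  apply: graded_pair_neg; rewrite !cstarM.
  by apply: pos_pair_mul_star w _; rewrite subnKC// ltnW.
- move=> /graded_pair_negV w w'; have [nm|mn] := leqP m n.
    rewrite -(cstarK a) -(cstarK d) -(subnKC nm) PoszD addrA addNr add0r /=.
    by apply: pos_pair_star_mul w _; rewrite subnKC.
  rewrite -(subnKC (ltnW mn)) PoszD opprD addrAC addNr add0r.
  apply: graded_pair_neg; rewrite !cstarM.
  by apply: pos_pair_star_mul w' _; rewrite subnKC// ltnW.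
- move=> /graded_pair_negV w /graded_pair_negV w'.
  rewrite -opprD -PoszD addnC; apply: graded_pair_neg; rewrite !cstarM.
  exact: pos_pair_mul.
Qed.

(** The pair [(a^* a, d^* d)] has degree zero, where the graph is that of the
    contraction [pi]. *)
Lemma graded_pair_le k a d : graded_pair k a d -> nrm d <= nrm a.
Proof.
move=> H; have := graded_pairM (graded_pair_star H) H.
rewrite addNr => /pos_pair0_inv [b aE dE].
rewrite -(@ler_pXn2r _ 2)// ?nnegrE ?nrm_ge0// -!nrm_star_mul aE dE.
exact: (star_hom_nrm b piH).
Qed.

(** The graph of the partial homomorphism, filtered so that bandwidths add under
    products. *)
Inductive band (N : nat) : A -> D -> Prop :=
| band0 : band N 0 0
| bandS k a d a' d' : (`|k| <= N)%N -> graded_pair k a d -> band N a' d' ->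
    band N (a + a') (d + d').

Lemma graded_pair_band (N : nat) k a d : (`|k| <= N)%N -> graded_pair k a d ->
  band N a d.
Proof. by move=> kN H; rewrite -(addr0 a) -(addr0 d); apply: bandS kN H (band0 _). Qed.

Lemma bandW M N a d : (M <= N)%N -> band M a d -> band N a d.
Proof.
move=> MN; elim=> {a d} [|k a d a' d' kM H _ IH]; first exact: band0.
exact: bandS (leq_trans kM MN) H IH.
Qed.

Lemma bandL N (l : R[i]) a d a' d' : band N a d -> band N a' d' ->
  band N (l *: a + a') (l *: d + d').
Proof.
move=> H H'; elim: H => {a d} [|k a d b e kN H _ IH].
  by rewrite !scaler0 !add0r.
rewrite !scalerDr -!addrA; apply: bandS kN _ IH.
by have := graded_pairL l H (graded_pair0 k); rewrite !addr0.
Qed.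

Lemma bandM M N a d a' d' : band M a d -> band N a' d' ->
  band (M + N) (a ** a') (d ** d').
Proof.
move=> H H'; elim: H => {a d} [|k a d b e kM H _ IH].
  by rewrite !cmul0l; exact: band0.
rewrite !cmulDl -[a ** a']scale1r -[d ** d']scale1r.
apply: bandL; [clear IH|exact: IH].
elim: H' => {a' d'} [|l a' d' b' e' lN H' _ IH'].
  by rewrite !cmul0r; exact: band0.
rewrite !cmulDr; apply: bandS (graded_pairM H H') IH'.
lia.
Qed.

Lemma band_star N a d : band N a d -> band N (cstar a) (cstar d).
Proof.
elim=> {a d} [|k a d a' d' kN H _ IH]; first by rewrite !cstar0; exact: band0.
rewrite !cstarD; apply: bandS (graded_pair_star H) IH.
by rewrite abszN.
Qed.

(** Terms of equal degree are collected, because the norm estimate must count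
    degrees, not summands. *)
Lemma band_decomp N a d : band N a d ->
  exists (u : int -> A) (v : int -> D),
    [/\ forall k, graded_pair k (u k) (v k),
        a = \sum_(i < (2 * N).+1) u (i%:Z - N%:Z) &
        d = \sum_(i < (2 * N).+1) v (i%:Z - N%:Z)].
Proof.
elim=> {a d} [|k a d a' d' kN H _ [u [v [uv -> ->]]]].
  exists (fun=> 0), (fun=> 0); rewrite !big1//; split=> // k.
  exact: graded_pair0.
have iN : (absz (k + N%:Z)%R < (2 * N).+1)%N by lia.
pose i0 := Ordinal iN.
have pick_sum (V : zmodType) (w : V) :
    \sum_(i < (2 * N).+1) (if i%:Z - N%:Z == k then w else 0) = w.
  rewrite -big_mkcond/= (big_pred1 i0)// => i.
  rewrite /= -val_eqE/=; apply/eqP/eqP; lia.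
exists (fun l => (if l == k then a else 0) + u l).
exists (fun l => (if l == k then d else 0) + v l).
rewrite !big_split !pick_sum; split=> // l.
case: eqP => [->|_]; last by rewrite !add0r.
by have := graded_pairL 1 H (uv k); rewrite !scale1r.
Qed.

Lemma band_le_lin N a d : band N a d -> nrm d <= (2 * N).+1%:R * nrm a.
Proof.
move=> /band_decomp [u [v [uv -> ->]]]; apply: nrm_sum => i.
rewrite (le_trans (graded_pair_le (uv _)))//.
by apply: component_le => k; exact: graded_pair_gr (uv k).
Qed.

Lemma band_cpow N a d n : band N a d -> band (n.+1 * N) (cpow a n) (cpow d n).
Proof.
move=> H; elim: n => [|n IH]; first by rewrite mul1n.
by rewrite mulSn; exact: bandM.
Qed.

(** The power [n] of a self-adjoint element of bandwidth [M] has bandwidth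
    [n M], so passing from [A] to [D] multiplies its norm by at most
    [2 n M + 1].  By the C*-identity [n]-th roots may be taken, and the linear
    factor disappears. *)
Lemma band_le N a d : band N a d -> nrm d <= nrm a.
Proof.
move=> H; rewrite -(@ler_pXn2r _ 2)// ?nnegrE ?nrm_ge0// -!nrm_star_mul.
have H2 := bandM (band_star H) H; set M := (N + N)%N in H2.
apply: (@expr_growth _ _ _ (2 * M%:R) 1); try exact: nrm_ge0.
move=> n; rewrite -!nrm_cpow ?cstarM ?cstarK//.
apply: le_trans (band_le_lin (band_cpow n H2)) _.
by rewrite -natr1 !natrM mulrAC mulrA.
Qed.

Hypothesis Gs : strong G.

Lemma covariant_extends : exists f : A -> D,
  [/\ star_hom f, f \o @val0 _ _ G = pi & f \o @val1 _ _ G = psi].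
Proof.
pose T a d := exists N, band N a d.
have TL (k : R[i]) a d a' d' : T a d -> T a' d' -> T (k *: a + a') (k *: d + d').
  move=> [M H] [N H']; exists (maxn M N); apply: bandL.
    exact: bandW (leq_maxl _ _) H.
  exact: bandW (leq_maxr _ _) H'.
have TM a d a' d' : T a d -> T a' d' -> T (a ** a') (d ** d').
  by move=> [M H] [N H']; exists (M + N)%N; exact: bandM.
have TS a d : T a d -> T (cstar a) (cstar d).
  by move=> [N H]; exists N; exact: band_star.
have T_le a d : T a d -> nrm d <= nrm a by move=> [N]; exact: band_le.
have T0 b : T (sub_val b) (pi b).
  by exists 0%N; apply: (@graded_pair_band _ 0) => //; exact: pos_pair0.
have T1 x : T (sub_val x) (psi x).
  by exists 1%N; apply: (@graded_pair_band _ 1) => //; exact: pos_pair1.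
pose M : set A := [set a | exists d, T a d].
have clM : closure M = setT.
  apply: dense_of_generates (A0_A1_generate Gs) _ _ _ _ _.
  - move=> _ [[b _ <-]|[x _ <-]]; first by exists (pi b); exact: T0.
    by exists (psi x); exact: T1.
  - by exists 0, 0%N; exact: band0.
  - by move=> k a a' [d H] [d' H']; exists (k *: d + d'); exact: TL.
  - by move=> a a' [d H] [d' H']; exists (d ** d'); exact: TM.
  - by move=> a [d H]; exists (cstar d); exact: TS.
have T_dense a (e : R) : 0 < e -> exists a' d', T a' d' /\ nrm (a - a') < e.
  move=> e0; have /closureP/(_ e e0) [a' [d' H] h] : closure M a by rewrite clM.
  by exists a', d'.
have [f [fH fT]] := star_hom_extension TL TM TS T_le T_dense.
exists f; split=> //; apply/funext => x; apply: fT;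
  [exact: T0|exact: T1].
Qed.

End Universal.

(** * Strongly graded algebras are Cuntz-Pimsner algebras *)

Unset Implicit Arguments.

Theorem lemma2p1 (R : realType) (A : cstarAlgType R) (G : zgrading A) :
  sigma_unital A -> strong G ->
  [/\ correspondence (A1_corr G),
      full (A1_corr G),
      compact_left_action (A1_corr G),
      injective_left_action (A1_corr G) &
      (exists (O : cstarAlgType R) (jB : A0 G -> O) (jX : A1 G -> O),
         cuntz_pimsner (A1_corr G) jB jX) /\
      (forall (O : cstarAlgType R) (jB : A0 G -> O) (jX : A1 G -> O),
         cuntz_pimsner (A1_corr G) jB jX ->
         exists Psi : A -> O,
           [/\ star_iso Psi,
               forall x : A1 G, Psi (sub_val x) = jX x &
               forall b : A0 G, Psi (sub_val b) = jB b])].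
Proof.
move=> _ Gs; split.
- exact: A1_correspondence.
- exact: A1_full.
- exact: A1_compact.
- exact: lact_inj.
have AO : cuntz_pimsner (A1_corr G) (@val0 _ _ G) (@val1 _ _ G).
  split; [exact: val_covariant|exact: A0_A1_generate|].
  by move=> D pi psi cov; exact: covariant_extends.
split; first by exists A, (@val0 _ _ G), (@val1 _ _ G).
move=> O jB jX [covO genO univO].
have [_ genA univA] := AO.
have [f [fH fB fX]] := univA _ _ _ covO.
have [g [gH gB gX]] := univO _ _ _ (val_covariant Gs).
have fB' b : f (sub_val b) = jB b by rewrite -fB.
have fX' x : f (sub_val x) = jX x by rewrite -fX.
have gB' b : g (jB b) = sub_val b by have := congr1 (@^~ b) gB.
have gX' x : g (jX x) = sub_val x by have := congr1 (@^~ x) gX.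
exists f; split=> //; split=> //; exists g => a.
- have -> // : g (f a) = (g \o f) a by [].
  have -> // : g \o f = id.
  apply: (star_hom_eq genA) => [|//|]; first exact: star_hom_comp.
  by move=> _ [[b _ <-]|[x _ <-]] /=; rewrite ?fB' ?gB' ?fX' ?gX'.
- have -> // : f (g a) = (f \o g) a by [].
  have -> // : f \o g = id.
  apply: (star_hom_eq genO) => [|//|]; first exact: star_hom_comp.
  by move=> _ [[b _ <-]|[x _ <-]] /=; rewrite ?gB' ?fB' ?gX' ?fX'.
Qed.
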